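(* Let $\alpha, \theta$ be nonconstant inner functions such that $\alpha$ divides $\theta$, and let $A\colon K^2_\theta\to K^2_\alpha$ be a bounded operator. Then $A\in\mathcal{T}(\theta,\alpha)$ if and only if there are $\mu\in K^2_\alpha$ and $\nu\in K^2_\theta$ such that $$A-S_\alpha^* A S_\theta=\mu\otimes \tilde{k}_0^\theta+\tilde{k}_0^\alpha\otimes \nu.$$
   Context: $L^2=L^2(\mathbb T,m)$ with $\mathbb T$ the unit circle and $m$ normalized Lebesgue measure; $H^2\subset L^2$ is the Hardy space of the unit disc. For an inner function $u$, $K^2_u=H^2\ominus uH^2$, $P_u\colon L^2\to K^2_u$ is the orthogonal projection, $\tilde k_0^u=\bar z(u-u(0))\in K_u^2$, and $S_u\colon K_u^2\to K_u^2$, $S_uf=P_u(zf)$, is the compressed shift. $\alpha$ divides $\theta$ means that $\theta/\alpha=\bar\alpha\theta$ is inner. $(x\otimes y)f=\langle f,y\rangle x$. For $\varphi\in L^2$, $A_\varphi^{\theta,\alpha}f=P_\alpha(\varphi f)$ with domain $\{f\in K^2_\theta:\varphi f\in L^2\}$, which contains the dense subspace $K^2_\theta\cap H^\infty$; if it is bounded, $A_\varphi^{\theta,\alpha}$ also denotes its unique bounded extension $K^2_\theta\to K^2_\alpha$. $\mathcal T(\theta,\alpha)$ is the space of all bounded operators $K^2_\theta\to K^2_\alpha$ so obtained with $\varphi\in L^2$. *)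

(* Defs.v *)
From HB Require Import structures.
From mathcomp Require Import all_boot all_order all_algebra.
From mathcomp Require Import all_classical all_reals all_analysis.
From mathcomp Require Import measurable_realfun.
From mathcomp Require Import complex ring lra.

Set Implicit Arguments.
Unset Strict Implicit.
Unset Printing Implicit Defensive.

Import Order.TTheory GRing.Theory Num.Theory.
Import numFieldNormedType.Exports.

Local Open Scope classical_set_scope.
Local Open Scope ring_scope.
Local Open Scope complex_scope.

(* The circle is parametrised by t |-> exp (2 pi i t), t in [0, 1], which
   transports Lebesgue measure on [0, 1] to normalized Lebesgue measure m. A
   function on the circle is thus a function R -> R[i], of which only the
   restriction to [0, 1] matters. *)
Definition circ (R : realType) : set R := `[0, 1].
Arguments circ : clear implicits.

Definition ae_circ (R : realType) (f g : R -> R[i]) : Prop :=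
  {ae @lebesgue_measure R, forall t, circ R t -> f t = g t}.

(* The function z^n of the circle variable z, i.e. exp (2 pi i n t). *)
Definition zpow (R : realType) (n : int) (t : R) : R[i] :=
  cos (2 * pi * n%:~R * t) +i* sin (2 * pi * n%:~R * t).

Definition cint (R : realType) (f : R -> R[i]) : R[i] :=
  Rintegral (@lebesgue_measure R) (circ R) (fun t => complex.Re (f t)) +i*
  Rintegral (@lebesgue_measure R) (circ R) (fun t => complex.Im (f t)).

Definition abs2 (R : realType) (w : R[i]) : R :=
  complex.Re w ^+ 2 + complex.Im w ^+ 2.

Definition is_L2 (R : realType) (f : R -> R[i]) : Prop :=
  [/\ measurable_fun (circ R) (fun t => complex.Re (f t)),
      measurable_fun (circ R) (fun t => complex.Im (f t)) &
      (@lebesgue_measure R).-integrable (circ R) (fun t => (abs2 (f t))%:E)].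

Definition L2pred (R : realType) : {pred (R -> R[i])} :=
  [pred f | `[< is_L2 f >]].

Section L2_functions.
Variable R : realType.
Local Notation mu := (@lebesgue_measure R).
Local Notation D := (circ R).

Lemma measurable_circ : measurable D.
Proof. exact: measurable_itv. Qed.

Lemma ReD (x y : R[i]) : complex.Re (x + y) = complex.Re x + complex.Re y.
Proof. by case: x => ? ?; case: y. Qed.
Lemma ImD (x y : R[i]) : complex.Im (x + y) = complex.Im x + complex.Im y.
Proof. by case: x => ? ?; case: y. Qed.
Lemma ReM (x y : R[i]) : complex.Re (x * y) =
  complex.Re x * complex.Re y - complex.Im x * complex.Im y.
Proof. by case: x => ? ?; case: y. Qed.
Lemma ImM (x y : R[i]) : complex.Im (x * y) =
  complex.Re x * complex.Im y + complex.Im x * complex.Re y.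
Proof. by case: x => ? ?; case: y. Qed.
Lemma ReC (x : R[i]) : complex.Re (x^*)%C = complex.Re x.
Proof. by case: x. Qed.
Lemma ImC (x : R[i]) : complex.Im (x^*)%C = - complex.Im x.
Proof. by case: x. Qed.

Lemma abs2_ge0 (x : R[i]) : 0 <= abs2 x.
Proof. by rewrite addr_ge0// sqr_ge0. Qed.

Lemma abs2_comb (a x y : R[i]) :
  abs2 (a * x + y) <= 2 * abs2 a * abs2 x + 2 * abs2 y.
Proof.
rewrite /abs2 ReD ImD ReM ImM -subr_ge0.
set a1 := complex.Re a; set a2 := complex.Im a.
set x1 := complex.Re x; set x2 := complex.Im x.
set y1 := complex.Re y; set y2 := complex.Im y.
suff -> : 2 * (a1 ^+ 2 + a2 ^+ 2) * (x1 ^+ 2 + x2 ^+ 2) + 2 * (y1 ^+ 2 + y2 ^+ 2)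
  - ((a1 * x1 - a2 * x2 + y1) ^+ 2 + (a1 * x2 + a2 * x1 + y2) ^+ 2)
  = (a1 * x1 - a2 * x2 - y1) ^+ 2 + (a1 * x2 + a2 * x1 - y2) ^+ 2.
  by rewrite addr_ge0// sqr_ge0.
by ring.
Qed.

Lemma measurable_abs2 (f : R -> R[i]) :
  measurable_fun D (fun t => complex.Re (f t)) ->
  measurable_fun D (fun t => complex.Im (f t)) ->
  measurable_fun D (fun t => abs2 (f t)).
Proof.
move=> mr mi; apply: measurable_funD; exact: measurable_funX.
Qed.

Lemma L2_submod_closed : submod_closed (@L2pred R).
Proof.
split.
  apply/asboolP; split; [exact: measurable_cst|exact: measurable_cst|].
  rewrite [X in integrable _ _ X](_ : _ = cst 0%E); first exact: integrable0.
  by apply/funext => t /=; rewrite /abs2/= expr0n/= addr0.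
move=> a f g /asboolP[fr fi f2] /asboolP[gr gi g2]; apply/asboolP.
have mr : measurable_fun D (fun t => complex.Re ((a *: f + g) t)).
  rewrite [X in measurable_fun _ X](_ : _ = fun t =>
    (complex.Re a * complex.Re (f t) - complex.Im a * complex.Im (f t))
    + complex.Re (g t)); last by apply/funext => t; rewrite !fctE ReD ReM.
  apply: measurable_funD => //.
  by apply: measurable_funB;
    apply: measurable_funM.
have mi : measurable_fun D (fun t => complex.Im ((a *: f + g) t)).
  rewrite [X in measurable_fun _ X](_ : _ = fun t =>
    (complex.Re a * complex.Im (f t) + complex.Im a * complex.Re (f t))
    + complex.Im (g t)); last by apply/funext => t; rewrite !fctE ImD ImM.
  apply: measurable_funD => //.
  by apply: measurable_funD;
    apply: measurable_funM.
split=> //.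
apply: (@le_integrable _ (measurableTypeR R) R mu D measurable_circ _ (fun t =>

  ((2 * abs2 a)%:E * (abs2 (f t))%:E + 2%:E * (abs2 (g t))%:E)%E)).
- by apply/measurable_EFinP; exact: measurable_abs2.
- move=> t Dt /=; rewrite lee_fin.
  rewrite ger0_norm ?abs2_ge0// (le_trans (abs2_comb _ _ _))// ler_norm//.
- apply: integrableD => //; first exact: measurable_circ.
  + by apply: integrableZl => //; exact: measurable_circ.
  + by apply: integrableZl => //; exact: measurable_circ.
Qed.

HB.instance Definition _ :=
  GRing.isSubmodClosed.Build R[i] (R -> R[i]) (@L2pred R) L2_submod_closed.

Definition cintegrable (f : R -> R[i]) : Prop :=
  mu.-integrable D (fun t => (complex.Re (f t))%:E) /\
  mu.-integrable D (fun t => (complex.Im (f t))%:E).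

Lemma cint_linear a (f g : R -> R[i]) : cintegrable f -> cintegrable g ->
  cint (fun t => a * f t + g t) = a * cint f + cint g.
Proof.
move=> [fr fi] [gr gi]; rewrite /cint.
have intZ (b : R) (h : R -> R) : mu.-integrable D (fun t => (h t)%:E) ->
    mu.-integrable D (fun t => (b * h t)%:E).
  move=> ih; rewrite [X in integrable _ _ X](_ : _ =
    fun t => (b%:E * (h t)%:E)%E)//.
  by apply: integrableZl => //; exact: measurable_circ.
have intD (h k : R -> R) : mu.-integrable D (fun t => (h t)%:E) ->
    mu.-integrable D (fun t => (k t)%:E) ->
    mu.-integrable D (fun t => (h t + k t)%:E).
  move=> ih ik; rewrite [X in integrable _ _ X](_ : _ =
    fun t => ((h t)%:E + (k t)%:E)%E)//.
  by apply: integrableD => //; exact: measurable_circ.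
apply/eqP; rewrite eq_complex ReD ImD ReM ImM /=; apply/andP; split; apply/eqP.
- under eq_Rintegral => t _.
    rewrite ReD ReM -mulNr; over.
  rewrite /= RintegralD; [|exact: measurable_circ| |exact: gr].
    rewrite RintegralD; [|exact: measurable_circ|exact: intZ|exact: intZ].
    by rewrite !RintegralZl ?mulNr//; exact: measurable_circ.
  by apply: intD; exact: intZ.
- under eq_Rintegral => t _.
    rewrite ImD ImM; over.
  rewrite /= RintegralD; [|exact: measurable_circ| |exact: gi].
    rewrite RintegralD; [|exact: measurable_circ|exact: intZ|exact: intZ].
    by rewrite !RintegralZl//; exact: measurable_circ.
  by apply: intD; exact: intZ.
Qed.

Lemma ae_cint (f g : R -> R[i]) : cintegrable f -> cintegrable g ->
  ae_circ f g -> cint f = cint g.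
Proof.
move=> [fr fi] [gr gi] fg; rewrite /cint /Rintegral; congr (fine _ +i* fine _).
- apply: (@ae_eq_integral _ (measurableTypeR R)).
  + exact: measurable_circ.
  + exact: (measurable_int mu).
  + exact: (measurable_int mu).
  + apply: (@filterS _ _ (ae_filter_ringOfSetsType mu)) fg => t fg Dt.
    by rewrite fg.
- apply: (@ae_eq_integral _ (measurableTypeR R)).
  + exact: measurable_circ.
  + exact: (measurable_int mu).
  + exact: (measurable_int mu).
  + apply: (@filterS _ _ (ae_filter_ringOfSetsType mu)) fg => t fg Dt.
    by rewrite fg.
Qed.

Lemma norm_dot_le (a b c d : R) :
  `|a * c + b * d| <= a ^+ 2 + b ^+ 2 + (c ^+ 2 + d ^+ 2).
Proof.
have := sqr_ge0 (a - c); have := sqr_ge0 (a + c).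
have := sqr_ge0 (b - d); have := sqr_ge0 (b + d).
have := sqr_ge0 a; have := sqr_ge0 b; have := sqr_ge0 c; have := sqr_ge0 d.
by move=> *; rewrite ler_norml; apply/andP; split; nra.
Qed.

Lemma cintegrable_mul_conj (f g : R -> R[i]) : is_L2 f -> is_L2 g ->
  cintegrable (fun t => f t * (g t)^*%C).
Proof.
move=> [fr fi f2] [gr gi g2].
have bnd (h : R -> R) : measurable_fun D h ->
    (forall t, `|h t| <= abs2 (f t) + abs2 (g t)) ->
    mu.-integrable D (fun t => (h t)%:E).
  move=> mh hle.
  apply: (@le_integrable _ (measurableTypeR R) R mu D measurable_circ _
    (fun t => ((abs2 (f t))%:E + (abs2 (g t))%:E)%E)).
  - exact/measurable_EFinP.
  - move=> t Dt /=; rewrite lee_fin (le_trans (hle t))// ler_norm//.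
  - by apply: integrableD => //; exact: measurable_circ.
split; apply: bnd.
- rewrite [X in measurable_fun _ X](_ : _ = fun t =>
    complex.Re (f t) * complex.Re (g t) + complex.Im (f t) * complex.Im (g t)).
    by apply: measurable_funD; apply: measurable_funM.
  by apply/funext => t; rewrite ReM ReC ImC mulrN opprK.
- by move=> t; rewrite ReM ReC ImC mulrN opprK norm_dot_le.
- rewrite [X in measurable_fun _ X](_ : _ = fun t =>
    complex.Im (f t) * complex.Re (g t) - complex.Re (f t) * complex.Im (g t)).
    by apply: measurable_funB; apply: measurable_funM.
  by apply/funext => t; rewrite ImM ReC ImC mulrN addrC.
- move=> t; rewrite ImM ReC ImC /abs2 mulrN -mulNr.
  rewrite [leLHS](_ : _ = `|complex.Re (f t) * (- complex.Im (g t)) +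
    complex.Im (f t) * complex.Re (g t)|); last by rewrite mulrN -mulNr.
  by rewrite (le_trans (norm_dot_le _ _ _ _))// sqrrN lerD2l addrC.
Qed.

Lemma is_L2_zpow (n : int) : is_L2 (@zpow R n).
Proof.
have mlin : measurable_fun D (fun t : R => 2 * pi * n%:~R * t).
  exact: measurable_funM.
have mcos : measurable_fun D (fun t : R => cos (2 * pi * n%:~R * t)).
  apply: (@measurableT_comp _ _ _ _ _ _ (@cos R)) => //.
  by apply: continuous_measurable_fun; exact: continuous_cos.
have msin : measurable_fun D (fun t : R => sin (2 * pi * n%:~R * t)).
  apply: (@measurableT_comp _ _ _ _ _ _ (@sin R)) => //.
  by apply: continuous_measurable_fun; exact: continuous_sin.
split => //.
rewrite [X in integrable _ _ X](_ : _ = cst 1%E).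
  apply/integrableP; split; first exact: measurable_cst.
  rewrite /= normr1 integral_cst/=; last exact: measurable_circ.
  by rewrite mul1e /circ lebesgue_measure_itv/= lte_fin ltr01 oppr0 adde0 ltry.
by apply/funext => t; rewrite /abs2/= cos2Dsin2.
Qed.

End L2_functions.

Record L2fun (R : realType) := MkL2fun {
  L2val :> R -> R[i];
  L2valP : L2val \in @L2pred R }.

HB.instance Definition _ (R : realType) := [isSub for @L2val R].
HB.instance Definition _ (R : realType) := [Choice of L2fun R by <:].
HB.instance Definition _ (R : realType) :=
  [SubChoice_isSubLmodule of L2fun R by <:].

Lemma L2valN (R : realType) (f : L2fun R) t : (- f : L2fun R) t = - f t.
Proof. by []. Qed.
Lemma L2valD (R : realType) (f g : L2fun R) t : (f + g : L2fun R) t = f t + g t.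
Proof. by []. Qed.
Lemma L2valZ (R : realType) a (f : L2fun R) t : (a *: f : L2fun R) t = a * f t.
Proof. by []. Qed.

Section L2_space.
Variable R : realType.
Local Notation mu := (@lebesgue_measure R).
Local Notation D := (circ R).

Lemma ae_circS (f g h k : R -> R[i]) :
  (forall t, f t = g t -> h t = k t) -> ae_circ f g -> ae_circ h k.
Proof.
move=> H.
apply: (@filterS _ _ (ae_filter_ringOfSetsType mu)) => t fg Dt.
exact/H/fg.
Qed.

Lemma ae_circS2 (f g f' g' h k : R -> R[i]) :
  (forall t, f t = g t -> f' t = g' t -> h t = k t) ->
  ae_circ f g -> ae_circ f' g' -> ae_circ h k.
Proof.
move=> H.
apply: (@filterS2 _ _ (ae_filter_ringOfSetsType mu)) => t fg fg' Dt.
by apply: H; [exact: fg|exact: fg'].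
Qed.


Definition aeL2 (f g : L2fun R) : bool := `[< ae_circ f g >].

Lemma aeL2_refl : reflexive aeL2.
Proof. by move=> f; apply/asboolP; exact: aeW. Qed.

Lemma aeL2_sym : symmetric aeL2.
Proof.
by move=> f g; apply/idP/idP => /asboolP h; apply/asboolP;
  apply: ae_circS h => t ->.
Qed.

Lemma aeL2_trans : transitive aeL2.
Proof.
move=> f g h /asboolP gf /asboolP fh; apply/asboolP.
by apply: ae_circS2 gf fh => t -> ->.
Qed.

Canonical aeL2_equiv := EquivRel aeL2 aeL2_refl aeL2_sym aeL2_trans.

Local Open Scope quotient_scope.

Definition L2 : Type := {eq_quot aeL2}.
HB.instance Definition _ := Choice.on L2.
HB.instance Definition _ := EqQuotient.on L2.

Lemma L2_eqP (f g : L2fun R) : ae_circ f g <-> \pi_L2 f = \pi_L2 g.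
Proof.
split => [h|/eqmodP/asboolP//].
by apply/eqmodP/asboolP.
Qed.

Lemma L2_reprP (f : L2fun R) : ae_circ (repr (\pi_L2 f)) f.
Proof. by apply/L2_eqP; rewrite reprK. Qed.

Definition L2_zero : L2 := \pi_L2 0.
Definition L2_opp (x : L2) : L2 := \pi_L2 (- repr x).
Definition L2_add (x y : L2) : L2 := \pi_L2 (repr x + repr y).
Definition L2_scale (a : R[i]) (x : L2) : L2 := \pi_L2 (a *: repr x).

Lemma L2_oppE (f : L2fun R) : L2_opp (\pi_L2 f) = \pi_L2 (- f).
Proof.
by apply/L2_eqP; apply: ae_circS (L2_reprP f) => t h; rewrite !(L2valN, L2valZ) h.
Qed.

Lemma L2_addE (f g : L2fun R) : L2_add (\pi_L2 f) (\pi_L2 g) = \pi_L2 (f + g).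
Proof.
apply/L2_eqP; apply: ae_circS2 (L2_reprP f) (L2_reprP g) => t hf hg.
by rewrite !L2valD hf hg.
Qed.

Lemma L2_scaleE a (f : L2fun R) : L2_scale a (\pi_L2 f) = \pi_L2 (a *: f).
Proof.
by apply/L2_eqP; apply: ae_circS (L2_reprP f) => t h; rewrite !(L2valN, L2valZ) h.
Qed.

Lemma L2_surj (x : L2) : exists f, x = \pi_L2 f.
Proof. by exists (repr x); rewrite reprK. Qed.

Lemma L2_addA : associative L2_add.
Proof.
move=> x y z; have [f ->] := L2_surj x.
have [g ->] := L2_surj y; have [h ->] := L2_surj z.
by rewrite (L2_addE g h) (L2_addE f g) (L2_addE f (g + h))
  (L2_addE (f + g) h) addrA.
Qed.

Lemma L2_addC : commutative L2_add.
Proof.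
move=> x y; have [f ->] := L2_surj x; have [g ->] := L2_surj y.
by rewrite (L2_addE f g) (L2_addE g f) addrC.
Qed.

Lemma L2_add0 : left_id L2_zero L2_add.
Proof.
by move=> x; have [f ->] := L2_surj x; rewrite (L2_addE 0 f) add0r.
Qed.

Lemma L2_addN : left_inverse L2_zero L2_opp L2_add.
Proof.
move=> x; have [f ->] := L2_surj x.
by rewrite (L2_oppE f) (L2_addE (- f) f) addNr.
Qed.

HB.instance Definition _ :=
  GRing.isZmodule.Build L2 L2_addA L2_addC L2_add0 L2_addN.

Lemma L2_scaleA a b (x : L2) : L2_scale a (L2_scale b x) = L2_scale (a * b) x.
Proof.
have [f ->] := L2_surj x.
by rewrite (L2_scaleE b f) (L2_scaleE a (b *: f)) (L2_scaleE (a * b) f) scalerA.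
Qed.

Lemma L2_scale1 : left_id 1 L2_scale.
Proof.
by move=> x; have [f ->] := L2_surj x; rewrite (L2_scaleE 1 f) scale1r.
Qed.

Lemma L2_scaleDr : right_distributive L2_scale +%R.
Proof.
move=> a x y; have [f ->] := L2_surj x; have [g ->] := L2_surj y.
change (L2_scale a (L2_add (\pi_L2 f) (\pi_L2 g)) =
  L2_add (L2_scale a (\pi_L2 f)) (L2_scale a (\pi_L2 g))).
by rewrite (L2_addE f g) (L2_scaleE a f) (L2_scaleE a g)
  (L2_scaleE a (f + g)) (L2_addE (a *: f) (a *: g)) scalerDr.
Qed.

Lemma L2_scaleDl (x : L2) : {morph L2_scale^~ x : a b / a + b}.
Proof.
move=> a b; have [f ->] := L2_surj x.
change (L2_scale (a + b) (\pi_L2 f) =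
  L2_add (L2_scale a (\pi_L2 f)) (L2_scale b (\pi_L2 f))).
by rewrite (L2_scaleE a f) (L2_scaleE b f) (L2_scaleE (a + b) f)
  (L2_addE (a *: f) (b *: f)) scalerDl.
Qed.

HB.instance Definition _ := GRing.Zmodule_isLmodule.Build R[i] L2
  L2_scaleA L2_scale1 L2_scaleDr L2_scaleDl.

End L2_space.

Definition L2rep (R : realType) (f : L2 R) : R -> R[i] := repr f.
Coercion L2rep : L2 >-> Funclass.

(* Class of f, with the junk value 0 when f is not square integrable. *)
Definition toL2 (R : realType) (f : R -> R[i]) : L2 R :=
  \pi_(L2 R)%qT (insubd 0 f).

Definition ip (R : realType) (f g : L2 R) : R[i] :=
  cint (fun t => f t * (g t)^*%C).

Definition L2norm (R : realType) (f : L2 R) : R :=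
  Num.sqrt (complex.Re (ip f f)).

Definition fourier (R : realType) (f : L2 R) (n : int) : R[i] :=
  cint (fun t => f t * (zpow n t)^*%C).

Definition H2 (R : realType) (f : L2 R) : Prop :=
  forall n : int, n < 0 -> fourier f n = 0.

(* H^2 (-) u H^2 *)
Definition K2pred (R : realType) (u : L2 R) : {pred L2 R} :=
  [pred f | `[< H2 f /\
    forall h, H2 h -> ip f (toL2 (fun t => u t * h t)) = 0 >]].

Section model_space_lmod.
Variable R : realType.
Implicit Types f g h u : L2 R.

Lemma L2repP f : is_L2 f.
Proof. by have /asboolP := L2valP (repr f). Qed.

Lemma toL2P (f : R -> R[i]) : is_L2 f -> ae_circ (toL2 f) f.
Proof.
move=> f2; have := L2_reprP (insubd 0 f).
by rewrite [X in ae_circ _ X]insubdK//; exact/asboolP.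
Qed.

Lemma L2rep_linear a f g :
  ae_circ (a *: f + g : L2 R) (fun t => a * f t + g t).
Proof.
have -> : a *: f + g = \pi_(L2 R)%qT (a *: repr f + repr g).
  rewrite -[in LHS](reprK f) -[in LHS](reprK g).
  change (L2_add (L2_scale a (\pi_(L2 R)%qT (repr f))) (\pi_(L2 R)%qT (repr g)) =
    \pi_(L2 R)%qT (a *: repr f + repr g)).
  by rewrite (L2_scaleE a (repr f)) (L2_addE (a *: repr f) (repr g)).
exact: L2_reprP.
Qed.

Lemma cint_mul_conj_linear a f g (h : R -> R[i]) : is_L2 h ->
  cint (fun t => (a *: f + g : L2 R) t * (h t)^*%C) =
  a * cint (fun t => f t * (h t)^*%C) + cint (fun t => g t * (h t)^*%C).
Proof.
move=> h2; rewrite -cint_linear; last 2 first.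
- exact: cintegrable_mul_conj (L2repP f) h2.
- exact: cintegrable_mul_conj (L2repP g) h2.
have E : (fun t => a * (f t * (h t)^*%C) + g t * (h t)^*%C) =
  (fun t => (a * f t + g t) * (h t)^*%C).
  by apply/funext => t; rewrite mulrDl mulrA.
rewrite E; apply: ae_cint.
- exact: cintegrable_mul_conj (L2repP _) h2.
- apply: cintegrable_mul_conj h2.
  have /asboolP := L2valP (a *: repr f + repr g).
  by [].
- by apply: ae_circS (L2rep_linear a f g) => t ->.
Qed.

Lemma K2_submod_closed u : submod_closed (K2pred u).
Proof.
have lin0 (h : R -> R[i]) : is_L2 h -> cint (fun t => (0 : L2 R) t * (h t)^*%C) = 0.
  move=> h2; have := cint_mul_conj_linear (-1) 0 0 h2.
  by rewrite scaler0 addr0 mulN1r addNr.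
split.
  apply/asboolP; split=> [n _|h _]; first exact: lin0 (is_L2_zpow R n).
  exact: lin0 (L2repP _).
move=> a f g /asboolP[Hf of_] /asboolP[Hg og]; apply/asboolP; split.
  move=> n n0; rewrite /fourier cint_mul_conj_linear; last exact: is_L2_zpow.
  by rewrite [X in a * X](Hf n n0) [X in _ + X](Hg n n0) mulr0 addr0.
move=> h Hh; rewrite /ip cint_mul_conj_linear; last exact: L2repP.
by rewrite [X in a * X](of_ h Hh) [X in _ + X](og h Hh) mulr0 addr0.
Qed.

HB.instance Definition _ u :=
  GRing.isSubmodClosed.Build R[i] (L2 R) (K2pred u) (K2_submod_closed u).

End model_space_lmod.

Record K2 (R : realType) (u : L2 R) := MkK2 {
  K2val :> L2 R;
  K2valP : K2val \in K2pred u }.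

HB.instance Definition _ (R : realType) (u : L2 R) := [isSub for @K2val R u].
HB.instance Definition _ (R : realType) (u : L2 R) := [Choice of K2 u by <:].
HB.instance Definition _ (R : realType) (u : L2 R) :=
  [SubChoice_isSubLmodule of K2 u by <:].

Section operators.
Variable R : realType.
Implicit Types u v alpha theta phi : L2 R.

(* Inner functions are represented by their boundary values; the value at the
   origin of an analytic function is its zeroth Fourier coefficient. *)
Definition inner_function u : Prop := H2 u /\ ae_circ (fun t => `|u t|) (cst 1).

Definition nonconstant u : Prop := ~ exists c : R[i], ae_circ u (cst c).

Definition divides alpha theta : Prop :=
  inner_function (toL2 (fun t => (alpha t)^*%C * theta t)).

(* xget returns an element of the given set, and 0 if it is empty. Here and for
   adjoint_op the set is a singleton: the space is a Hilbert space, and T is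
   always bounded and linear where adjoint_op T is used. *)
Definition proj_K2 u (f : L2 R) : K2 u :=
  xget 0 [set g : K2 u | forall h : K2 u, ip (f - K2val g) h = 0].

Definition compressed_shift u (f : K2 u) : K2 u :=
  proj_K2 u (toL2 (fun t => zpow 1 t * f t)).

Definition adjoint_op u v (T : K2 u -> K2 v) (g : K2 v) : K2 u :=
  xget 0 [set h : K2 u | forall f : K2 u, ip (T f) g = ip f h].

Definition ktilde0 u : L2 R :=
  toL2 (fun t => (zpow 1 t)^*%C * (u t - fourier u 0)).

Definition rank_one (x y f : L2 R) : L2 R := ip f y *: x.

Definition bounded_op u v (T : K2 u -> K2 v) : Prop :=
  exists c : R, forall f : K2 u, L2norm (T f) <= c * L2norm f.

Definition Adom theta phi : set (K2 theta) :=
  [set f | is_L2 (fun t => phi t * f t)].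

Definition Atrunc theta alpha phi (f : K2 theta) : K2 alpha :=
  proj_K2 alpha (toL2 (fun t => phi t * f t)).

Definition Atrunc_bounded theta alpha phi : Prop :=
  exists c : R, forall f : K2 theta, Adom phi f ->
    L2norm (Atrunc alpha phi f) <= c * L2norm f.

(* A belongs to T(theta, alpha): A is the bounded extension of a densely
   defined bounded A_phi. *)
Definition ATTO theta alpha (A : {linear K2 theta -> K2 alpha}) : Prop :=
  bounded_op A /\ exists phi : L2 R, Atrunc_bounded theta alpha phi /\
    forall f : K2 theta, Adom phi f -> A f = Atrunc alpha phi f.

End operators.

(* Main.v *)
Require Import Defs.
From mathcomp Require Import all_boot all_order all_algebra.
From mathcomp Require Import all_classical all_reals all_analysis.
From mathcomp Require Import measurable_realfun.
From mathcomp Require Import complex zify ring lra.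
Import Order.TTheory GRing.Theory Num.Theory.
Import numFieldNormedType.Exports.
Local Open Scope ring_scope.

Set Implicit Arguments.
Unset Strict Implicit.
Unset Printing Implicit Defensive.

(* For f, g in the model spaces, put a_n = <S_theta^n f, ktilde_theta> and
   c_n = <S_theta^n f, nu>, and likewise for g. Testing the operator equation
   against g and iterating it n times writes <A f, g> as the sum over j < n of
   a_j <mu, S_alpha^j g> + c_j <ktilde_alpha, S_alpha^j g>, up to the remainder
   <A S_theta^n f, S_alpha^n g>. The a_n are the Fourier coefficients of
   z conj(theta) f, which has no positive frequency, so Parseval gives
   |S_theta^n f|^2 = |f|^2 - sum_(j < n) |a_j|^2 -> 0, the remainder vanishes,
   and for bounded f and g Parseval sums the series to <phi f, g> with
     phi = z conj(theta) mu + conj(z) alpha conj(nu).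
   Conversely, for A = A_phi the explicit formula
   S_u f = z f - <f, ktilde_u> u gives the equation on bounded f, with
     mu = S_alpha^* P_alpha (phi theta), nu = P_theta (conj(z) conj(phi) alpha).
   Bounded functions are dense in K_theta because the projection of z^n is
   z^n - theta p with p a polynomial. *)
(** * Square integrable functions on the circle *)

(** Since phi is only square integrable, phi f need not be, and A_phi is under direct control only
    on bounded functions. Identities are therefore proved for bounded arguments and extended by
    density, in f and in g separately: for bounded g the form <f, g conj(phi)> makes sense for every
    f. The origin of phi: elements of K_theta cannot see multiples of theta, hence <S_theta^n f, nu>
    = <z^n f, nu>, the coefficient of f conj(nu) at frequency -n; likewise <S_alpha^n g, mu> is that
    of g conj(mu). As z conj(theta) f and z conj(alpha) g have no positive frequency, these
    one-sided sums are complete Parseval sums, and moving all factors next to f leaves phi. In the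
    remainder only S_theta^n f has to tend to 0; S_alpha^n g merely stays bounded. *)

Arguments ip : simpl never.
Arguments cint : simpl never.

Section circle_L2.
Local Open Scope classical_set_scope.
Local Open Scope complex_scope.
Variable R : realType.
Local Notation mu := (@lebesgue_measure R).
Local Notation D := (circ R).
Implicit Types (f g h : L2 R) (u v : R -> R[i]).

(** For [P t := f t = g t] this is convertible to [ae_circ f g], so one set of filter lemmas serves
    a.e. equalities and a.e. bounds. *)
Definition ae_on (P : R -> Prop) : Prop := {ae mu, forall t, D t -> P t}.

Lemma ae_onS (P Q : R -> Prop) : (forall t, P t -> Q t) -> ae_on P -> ae_on Q.
Proof.
move=> PQ; apply: (@filterS _ _ (ae_filter_ringOfSetsType mu)) => t Pt Dt.
exact/PQ/Pt.
Qed.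

Lemma ae_onS2 (P P' Q : R -> Prop) : (forall t, P t -> P' t -> Q t) ->
  ae_on P -> ae_on P' -> ae_on Q.
Proof.
move=> PQ; apply: (@filterS2 _ _ (ae_filter_ringOfSetsType mu)) => t Pt P't Dt.
exact: PQ (Pt Dt) (P't Dt).
Qed.

Lemma ae_on_mp (P Q : R -> Prop) :
  ae_on P -> ae_on (fun t => P t -> Q t) -> ae_on Q.
Proof. by move=> p pq; apply: ae_onS2 p pq => t Pt; apply. Qed.

Lemma ae_onW (P : R -> Prop) : (forall t, P t) -> ae_on P.
Proof. by move=> p; apply: aeW => t _; exact: p. Qed.

Lemma L2_ext f g : ae_circ f g -> f = g.
Proof. by move=> fg; rewrite -[f]reprK -[g]reprK; exact/L2_eqP. Qed.

Lemma L2_ae f g : f = g -> ae_circ f g.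
Proof. by move=> ->; exact: aeW. Qed.

Lemma L2DE f g : ae_circ (f + g : L2 R) (fun t => f t + g t).
Proof.
have := L2rep_linear 1 f g; rewrite scale1r.
by apply: ae_onS => t ->; rewrite mul1r.
Qed.

(** Representatives of classes are chosen, so even that of the class 0 vanishes only a.e.; this
    comes from linearity at -1 * 0 + 0 = 0. *)
Lemma L2_0E : ae_circ (0 : L2 R) (cst 0).
Proof.
have := L2rep_linear (-1) (0 : L2 R) 0; rewrite scaler0 addr0.
by apply: ae_onS => t {1}->; rewrite mulN1r addNr.
Qed.

Lemma L2ZE a f : ae_circ (a *: f : L2 R) (fun t => a * f t).
Proof.
have := L2rep_linear a f 0; rewrite addr0.
by apply: ae_onS2 L2_0E => t -> ->; rewrite addr0.
Qed.

Lemma L2NE f : ae_circ (- f : L2 R) (fun t => - f t).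
Proof.
by rewrite -scaleN1r; apply: ae_onS (L2ZE (-1) f) => t ->; rewrite mulN1r.
Qed.

Lemma L2BE f g : ae_circ (f - g : L2 R) (fun t => f t - g t).
Proof. by apply: ae_onS2 (L2DE f (- g)) (L2NE g) => t -> ->. Qed.

Lemma ip_ae f g f' g' :
  ae_circ (fun t => f t * (g t)^*%C) (fun t => f' t * (g' t)^*%C) ->
  ip f g = ip f' g'.
Proof.
by move=> fg; apply: ae_cint fg; apply: cintegrable_mul_conj; exact: L2repP.
Qed.

Lemma ip_linearl a f g h : ip (a *: f + g) h = a * ip f h + ip g h.
Proof. by rewrite /ip cint_mul_conj_linear//; exact: L2repP. Qed.

Lemma ipDl f g h : ip (f + g) h = ip f h + ip g h.
Proof. by have := ip_linearl 1 f g h; rewrite scale1r mul1r. Qed.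

Lemma ip0l h : ip 0 h = 0.
Proof. by have := ipDl 0 0 h; rewrite addr0 => /eqP; rewrite -subr_eq subrr => /eqP. Qed.

Lemma ipZl a f h : ip (a *: f) h = a * ip f h.
Proof. by have := ip_linearl a f 0 h; rewrite !addr0 ip0l addr0. Qed.

Lemma ipNl f h : ip (- f) h = - ip f h.
Proof. by rewrite -scaleN1r ipZl mulN1r. Qed.

Lemma ipBl f g h : ip (f - g) h = ip f h - ip g h.
Proof. by rewrite ipDl ipNl. Qed.

Lemma ip_suml (I : Type) (r : seq I) (P : pred I) (F : I -> L2 R) h :
  ip (\sum_(i <- r | P i) F i) h = \sum_(i <- r | P i) ip (F i) h.
Proof. exact: (big_morph (fun f => ip f h) (fun f g => ipDl f g h) (ip0l h)). Qed.

Lemma cint_conj (f : R -> R[i]) : cintegrable f ->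
  cint (fun t => (f t)^*%C) = (cint f)^*%C.
Proof.
move=> [fr fi]; rewrite /cint; apply/eqP; rewrite eq_complex /=.
apply/andP; split; apply/eqP.
  by apply: eq_Rintegral => t _; rewrite ReC.
under eq_Rintegral do rewrite ImC -mulN1r.
by rewrite RintegralZl ?mulN1r//; exact: measurable_circ.
Qed.

Lemma ip_conj f g : ip g f = (ip f g)^*%C.
Proof.
rewrite /ip -cint_conj; last by apply: cintegrable_mul_conj; exact: L2repP.
by congr cint; apply/funext => t; rewrite rmorphM/= conjcK mulrC.
Qed.

Lemma ipDr f g h : ip h (f + g) = ip h f + ip h g.
Proof. by rewrite ip_conj ipDl rmorphD (ip_conj f h) (ip_conj g h). Qed.

Lemma ipZr a f h : ip h (a *: f) = a^*%C * ip h f.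
Proof. by rewrite ip_conj ipZl rmorphM (ip_conj f h). Qed.

Lemma ipNr f h : ip h (- f) = - ip h f.
Proof. by rewrite ip_conj ipNl rmorphN (ip_conj f h). Qed.

Lemma ipBr f g h : ip h (f - g) = ip h f - ip h g.
Proof. by rewrite ipDr ipNr. Qed.

Lemma ip0r h : ip h 0 = 0.
Proof. by rewrite ip_conj ip0l rmorph0. Qed.

Definition nrm2 f : R := complex.Re (ip f f).

Lemma mulcJ (x : R[i]) : x * x^*%C = (abs2 x)%:C.
Proof.
by case: x => a b; rewrite /abs2; simpc; congr (_ +i* _); rewrite ?expr2 ?mulrN; ring.
Qed.

Lemma nrm2E f : nrm2 f = Rintegral mu D (fun t => abs2 (f t)).
Proof. by rewrite /nrm2 /ip /cint/=; apply: eq_Rintegral => t _; rewrite mulcJ. Qed.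

Lemma complex_real_conj (x : R[i]) : x = (x^*)%C -> x = (complex.Re x)%:C.
Proof. by case: x => a b [] h; congr (_ +i* _); lra. Qed.

Lemma ip_self f : ip f f = (nrm2 f)%:C.
Proof. exact: complex_real_conj (ip_conj f f). Qed.

Lemma nrm2_ge0 f : 0 <= nrm2 f.
Proof. by rewrite nrm2E; apply: Rintegral_ge0 => t _; exact: abs2_ge0. Qed.

Lemma nrm2_EFin f : (nrm2 f)%:E = (\int[mu]_(t in D) (abs2 (f t))%:E)%E.
Proof.
rewrite nrm2E /Rintegral fineK//; apply: integrable_fin_num.
  exact: measurable_circ.
by have [] := L2repP f.
Qed.

Lemma abs2_eq0 (x : R[i]) : (abs2 x == 0) = (x == 0).
Proof.
by case: x => a b; rewrite /abs2 /= paddr_eq0 ?sqr_ge0// !sqrf_eq0 eq_complex.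
Qed.

Lemma nrm2_eq0 f : nrm2 f = 0 -> f = 0.
Proof.
move=> f0; apply: L2_ext; have [fr fi f2] := L2repP f.
have := nrm2_EFin f; rewrite f0 => /esym h.
have mf : measurable_fun D (fun t => (abs2 (f t))%:E).
  by apply/measurable_EFinP; exact: measurable_abs2.
have /(@ae_eq_integral_abs _ (measurableTypeR R) R mu D (@measurable_circ R) _ mf) :
    (\int[mu]_(t in D) `|(abs2 (f t))%:E| = 0)%E.
  by apply: etrans h; apply: eq_integral => t _; rewrite gee0_abs// lee_fin abs2_ge0.
apply: ae_onS2 L2_0E => t -> [] /eqP.
by rewrite abs2_eq0 => /eqP.
Qed.

Lemma conjcM (x y : R[i]) : conjc (x * y) = conjc x * conjc y.
Proof. exact: rmorphM. Qed.

Lemma conjcD (x y : R[i]) : conjc (x + y) = conjc x + conjc y.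
Proof. exact: rmorphD. Qed.

Lemma abs2M (x y : R[i]) : abs2 (x * y) = abs2 x * abs2 y.
Proof. by case: x => a b; case: y => c d; rewrite /abs2; simpc => /=; ring. Qed.

Lemma abs2N (x : R[i]) : abs2 (- x) = abs2 x.
Proof. by case: x => a b; rewrite /abs2 /= !sqrrN. Qed.

Lemma abs2C (x : R[i]) : abs2 (x^*%C) = abs2 x.
Proof. by case: x => a b; rewrite /abs2 /= !sqrrN. Qed.

Lemma abs2_1 : abs2 (1 : R[i]) = 1.
Proof. by rewrite /abs2 /= expr1n expr0n addr0. Qed.

Lemma abs2_0 : abs2 (0 : R[i]) = 0.
Proof. by apply/eqP; rewrite abs2_eq0. Qed.

Lemma abs2D (x y : R[i]) : abs2 (x + y) <= 2 * abs2 x + 2 * abs2 y.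
Proof. by have := abs2_comb 1 x y; rewrite mul1r abs2_1 mulr1. Qed.

(** Collects the three error terms of [ip_recovered_bounded] into one multiple of [eps]; each of the
    two uses of [abs2D] costs a factor 2. *)
Lemma abs2D3_le (a b c : R[i]) (eps p q r C : R) :
  abs2 a <= eps * p -> abs2 b <= eps * q -> abs2 c <= C * eps * r ->
  abs2 (a + b + c) <= eps * (4 * p + 4 * q + 2 * C * r).
Proof.
move=> ap bq cr; have := abs2D (a + b) c; have := abs2D a b.
rewrite (_ : eps * _ = 4 * (eps * p) + 4 * (eps * q) + 2 * (C * eps * r)); last by ring.
move: ap bq cr; move: (abs2 a) (abs2 b) (abs2 c) (abs2 (a + b)) (abs2 (a + b + c)).
move: (eps * p) (eps * q) (C * eps * r) => *; lra.
Qed.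

Lemma abs2_norm (x : R[i]) : `|x| = 1 -> abs2 x = 1.
Proof.
by move=> x1; apply: (@complexI R); rewrite -mulcJ -sqr_normc x1 expr1n.
Qed.

Lemma nrm2Z a f : nrm2 (a *: f) = abs2 a * nrm2 f.
Proof. by rewrite /nrm2 ipZl ipZr mulrA mulcJ ip_self/= mul0r subr0. Qed.

Lemma nrm2N f : nrm2 (- f) = nrm2 f.
Proof. by rewrite -scaleN1r nrm2Z abs2N abs2_1 mul1r. Qed.

Lemma nrm2BC f g : nrm2 (f - g) = nrm2 (g - f).
Proof. by rewrite -nrm2N opprB. Qed.

Lemma cauchy_schwarz f g : abs2 (ip f g) <= nrm2 f * nrm2 g.
Proof.
have [g0|] := eqVneq (nrm2 g) 0.
  by rewrite g0 mulr0 (nrm2_eq0 g0) ip0r abs2_0.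
move=> gn0; have gp : 0 < nrm2 g by rewrite lt_def gn0 nrm2_ge0.
(* With G = |g|^2 this squared norm is G (|f|^2 G - |<f, g>|^2), and G is positive. *)
have := nrm2_ge0 ((nrm2 g)%:C *: f - ip f g *: g).
rewrite {1}/nrm2 !(ipBl, ipBr) !(ipZl, ipZr) !ip_self (ip_conj f g).
case E: (ip f g) => [a b]; rewrite /abs2 /=; simpc => /=.
move=> h.
rewrite -(ler_pM2l gp) -subr_ge0 (le_trans h)//; rewrite le_eqVlt; apply/orP; left; apply/eqP; ring.
Qed.

End circle_L2.

(** * Multiplication by bounded functions *)

Section multiplication.
Local Open Scope classical_set_scope.
Local Open Scope complex_scope.
Variable R : realType.
Local Notation mu := (@lebesgue_measure R).
Local Notation D := (circ R).
Implicit Types (f g h : L2 R) (u v : R -> R[i]).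

Definition cmeas u : Prop :=
  measurable_fun D (fun t => complex.Re (u t)) /\
  measurable_fun D (fun t => complex.Im (u t)).

Lemma cmeasM u v : cmeas u -> cmeas v -> cmeas (fun t => u t * v t).
Proof.
move=> [ur ui] [vr vi]; split.
  under eq_fun do rewrite Defs.ReM.
  by apply: measurable_funB; apply: measurable_funM.
under eq_fun do rewrite Defs.ImM.
by apply: measurable_funD; apply: measurable_funM.
Qed.

Lemma cmeasD u v : cmeas u -> cmeas v -> cmeas (fun t => u t + v t).
Proof.
move=> [ur ui] [vr vi]; split.
  by under eq_fun do rewrite ReD; apply: measurable_funD.
by under eq_fun do rewrite ImD; apply: measurable_funD.
Qed.

Lemma cmeasC u : cmeas u -> cmeas (fun t => (u t)^*%C).
Proof.
move=> [ur ui]; split; first by under eq_fun do rewrite ReC.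
by under eq_fun do rewrite ImC; apply: measurable_funN.
Qed.

Lemma cmeas_cst (c : R[i]) : cmeas (cst c).
Proof. by split; exact: measurable_cst. Qed.

Lemma is_L2_cmeas u : is_L2 u -> cmeas u. Proof. by case. Qed.

Lemma is_L2P u : cmeas u ->
  (\int[mu]_(t in D) (abs2 (u t))%:E < +oo)%E -> is_L2 u.
Proof.
move=> [ur ui] fin; split=> //; apply/integrableP; split.
  by apply/measurable_EFinP; exact: measurable_abs2.
apply: le_lt_trans fin; rewrite le_eqVlt; apply/orP; left; apply/eqP.
by apply: eq_integral => t _; rewrite gee0_abs// lee_fin abs2_ge0.
Qed.

Definition bounded_fun_ae u : Prop :=
  cmeas u /\ exists C : R, ae_on (fun t => abs2 (u t) <= C).

Lemma is_L2_mul u v : bounded_fun_ae u -> is_L2 v -> is_L2 (fun t => u t * v t).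
Proof.
move=> [mu_ [C uC]] v2; apply: is_L2P; first exact: cmeasM (is_L2_cmeas v2).
have [_ _ i2] := v2.
have iC : mu.-integrable D (fun t => `|C|%:E * (abs2 (v t))%:E)%E.
  by apply: integrableZl => //; exact: measurable_circ.
have fin : (\int[mu]_(t in D) (`|C|%:E * (abs2 (v t))%:E) < +oo)%E.
  exact: (@integrable_lty _ (measurableTypeR R) R mu D (@measurable_circ R)).
apply: le_lt_trans fin; apply: (@ae_ge0_le_integral _ (measurableTypeR R) R mu) => //.
- exact: measurable_circ.
- by move=> t _; rewrite lee_fin abs2_ge0.
- apply/measurable_EFinP; have [? ?] := cmeasM mu_ (is_L2_cmeas v2).
  exact: measurable_abs2.
- by move=> t _; rewrite -EFinM lee_fin mulr_ge0 ?abs2_ge0.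
- exact: (measurable_int mu).
- apply: ae_onS uC => t ut.
  rewrite -EFinM lee_fin abs2M ler_wpM2r ?abs2_ge0//.
  by rewrite (le_trans ut)// ler_norm.
Qed.

Lemma bounded_funM u v : bounded_fun_ae u -> bounded_fun_ae v ->
  bounded_fun_ae (fun t => u t * v t).
Proof.
move=> [mu_ [C uC]] [mv [E vE]]; split; first exact: cmeasM.
exists (`|C| * `|E|); apply: ae_onS2 uC vE => t ut vt.
rewrite abs2M ler_pM ?abs2_ge0//; first by rewrite (le_trans ut)// ler_norm.
by rewrite (le_trans vt)// ler_norm.
Qed.

Lemma bounded_funD u v : bounded_fun_ae u -> bounded_fun_ae v ->
  bounded_fun_ae (fun t => u t + v t).
Proof.
move=> [mu_ [C uC]] [mv [E vE]]; split; first exact: cmeasD.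
exists (2 * C + 2 * E); apply: ae_onS2 uC vE => t ut vt.
by rewrite (le_trans (abs2D _ _))// lerD// ler_pM2l.
Qed.

Lemma bounded_funC u : bounded_fun_ae u -> bounded_fun_ae (fun t => (u t)^*%C).
Proof.
move=> [mu_ [C uC]]; split; first exact: cmeasC.
by exists C; apply: ae_onS uC => t; rewrite abs2C.
Qed.

Lemma bounded_fun_cst (c : R[i]) : bounded_fun_ae (cst c).
Proof. by split; [exact: cmeas_cst|exists (abs2 c); exact: ae_onW]. Qed.

Lemma bounded_fun_ext f u : bounded_fun_ae u -> ae_circ f u -> bounded_fun_ae f.
Proof.
move=> [mu_ [C uC]] fu; split; first exact: is_L2_cmeas (L2repP f).
by exists C; apply: ae_onS2 uC fu => t ut ->.
Qed.

Lemma bounded_fun_sum (I : Type) (r : seq I) (a : I -> R[i])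
    (F : I -> L2 R) : (forall i, bounded_fun_ae (F i)) ->
  bounded_fun_ae (\sum_(i <- r) a i *: F i : L2 R).
Proof.
move=> bF; elim: r => [|i s IH].
  rewrite big_nil; apply: bounded_fun_ext (bounded_fun_cst (0 : R[i])) _.
  exact: L2_0E.
rewrite big_cons.
have b := bounded_funD (bounded_funM (bounded_fun_cst (a i)) (bF i)) IH.
apply: bounded_fun_ext b _; apply: ae_on_mp (L2ZE (a i) (F i)) _.
by apply: ae_onS (L2DE (a i *: F i) (\sum_(j <- s) a j *: F j)) => t -> ->.
Qed.

Lemma zpowD (m n : int) (t : R) : zpow (m + n) t = zpow m t * zpow n t.
Proof.
rewrite /zpow; simpc; rewrite intrD mulrDr mulrDl cosD sinD.
by congr (_ +i* _); rewrite addrC mulrC [X in _ + X]mulrC addrC.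
Qed.

Lemma zpow0 (t : R) : zpow 0 t = 1.
Proof. by rewrite /zpow mulr0 mul0r cos0 sin0. Qed.

Lemma zpowN (n : int) (t : R) : (zpow n t)^*%C = zpow (- n) t.
Proof. by rewrite /zpow /= intrN mulrN mulNr cosN sinN. Qed.

Lemma abs2_zpow (n : int) (t : R) : abs2 (zpow n t) = 1.
Proof. by rewrite /abs2 /= cos2Dsin2. Qed.

Definition unimodular u : Prop := cmeas u /\ ae_on (fun t => abs2 (u t) = 1).

Lemma unimodular_bounded u : unimodular u -> bounded_fun_ae u.
Proof. by move=> [mu_ u1]; split=> //; exists 1; apply: ae_onS u1 => t ->. Qed.

Lemma unimodular_zpow (n : int) : unimodular (@zpow R n).
Proof.
split; last by apply: ae_onW => t; exact: abs2_zpow.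
exact: is_L2_cmeas (is_L2_zpow R n).
Qed.

Lemma unimodularC u : unimodular u -> unimodular (fun t => (u t)^*%C).
Proof.
move=> [mu_ u1]; split; first exact: cmeasC.
by apply: ae_onS u1 => t; rewrite abs2C.
Qed.

Lemma inner_unimodular f : inner_function f -> unimodular f.
Proof.
move=> [_ f1]; split; first exact: is_L2_cmeas (L2repP f).
by apply: ae_onS f1 => t; exact: abs2_norm.
Qed.

Definition mulL2 u f : L2 R := toL2 (fun t => u t * f t).

Lemma mulL2E u f : bounded_fun_ae u -> ae_circ (mulL2 u f) (fun t => u t * f t).
Proof. by move=> bu; apply: toL2P; exact: is_L2_mul (L2repP f). Qed.

Lemma mulL2D u f g : bounded_fun_ae u -> mulL2 u (f + g) = mulL2 u f + mulL2 u g.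
Proof.
move=> bu; apply: L2_ext.
apply: ae_on_mp (mulL2E (f + g) bu) _; apply: ae_on_mp (L2DE f g) _.
apply: ae_on_mp (L2DE (mulL2 u f) (mulL2 u g)) _.
apply: ae_on_mp (mulL2E f bu) _; apply: ae_on_mp (mulL2E g bu) _.
by apply: ae_onW => t /= -> -> -> -> ->; rewrite mulrDr.
Qed.

Lemma mulL2Z u a f : bounded_fun_ae u -> mulL2 u (a *: f) = a *: mulL2 u f.
Proof.
move=> bu; apply: L2_ext.
apply: ae_on_mp (mulL2E (a *: f) bu) _; apply: ae_on_mp (L2ZE a f) _.
apply: ae_on_mp (L2ZE a (mulL2 u f)) _; apply: ae_on_mp (mulL2E f bu) _.
by apply: ae_onW => t /= -> -> -> ->; rewrite mulrCA.
Qed.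

Lemma mulL2N u f : bounded_fun_ae u -> mulL2 u (- f) = - mulL2 u f.
Proof. by move=> bu; rewrite -scaleN1r mulL2Z// scaleN1r. Qed.

Lemma mulL2B u f g : bounded_fun_ae u -> mulL2 u (f - g) = mulL2 u f - mulL2 u g.
Proof. by move=> bu; rewrite mulL2D// mulL2N. Qed.

Lemma mulL2_0 u : bounded_fun_ae u -> mulL2 u 0 = 0.
Proof. by move=> bu; have := mulL2Z 0 0 bu; rewrite !scale0r. Qed.

Lemma mulL2M u v f : bounded_fun_ae u -> bounded_fun_ae v ->
  mulL2 u (mulL2 v f) = mulL2 (fun t => u t * v t) f.
Proof.
move=> bu bv; apply: L2_ext.
apply: ae_on_mp (mulL2E (mulL2 v f) bu) _; apply: ae_on_mp (mulL2E f bv) _.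
apply: ae_on_mp (mulL2E f (bounded_funM bu bv)) _.
by apply: ae_onW => t /= -> -> ->; rewrite mulrA.
Qed.

Lemma mulL2_ae u v f : bounded_fun_ae u -> bounded_fun_ae v ->
  ae_on (fun t => u t = v t) -> mulL2 u f = mulL2 v f.
Proof.
move=> bu bv uv; apply: L2_ext; apply: ae_on_mp uv _.
apply: ae_on_mp (mulL2E f bu) _; apply: ae_on_mp (mulL2E f bv) _.
by apply: ae_onW => t /= -> -> ->.
Qed.

Lemma mulL2_1 u f : bounded_fun_ae u -> ae_on (fun t => u t = 1) -> mulL2 u f = f.
Proof.
move=> bu u1; apply: L2_ext; apply: ae_on_mp u1 _.
apply: ae_on_mp (mulL2E f bu) _.
by apply: ae_onW => t /= -> ->; rewrite mul1r.
Qed.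

Lemma mulL2_adj u f g : bounded_fun_ae u ->
  ip (mulL2 u f) g = ip f (mulL2 (fun t => (u t)^*%C) g).
Proof.
move=> bu; apply: ip_ae; apply: ae_on_mp (mulL2E f bu) _.
apply: ae_on_mp (mulL2E g (bounded_funC bu)) _.
by apply: ae_onW => t /= -> ->; rewrite rmorphM/= conjcK; ring.
Qed.

Lemma mulL2_unimodularK u f : unimodular u ->
  mulL2 (fun t => (u t)^*%C) (mulL2 u f) = f.
Proof.
move=> uu; have bu := unimodular_bounded uu.
rewrite mulL2M//; last exact: bounded_funC.
apply: mulL2_1; first by apply: bounded_funM => //; exact: bounded_funC.
by case: uu => _; apply: ae_onS => t ut; rewrite mulrC mulcJ ut.
Qed.

Lemma mulL2_iso u f g : unimodular u -> ip (mulL2 u f) (mulL2 u g) = ip f g.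
Proof.
by move=> uu; rewrite mulL2_adj ?mulL2_unimodularK//; exact: unimodular_bounded.
Qed.

(** Both sides are the class, possibly junk, of one pointwise product. It lets the bounded factor be
    put first. *)
Lemma mulL2C f g : mulL2 f g = mulL2 g f.
Proof. by rewrite /mulL2; congr toL2; apply/funext => t; rewrite mulrC. Qed.

Definition conjL2 f : L2 R := toL2 (fun t => (f t)^*%C).

Lemma conjL2E f : ae_circ (conjL2 f) (fun t => (f t)^*%C).
Proof.
apply: toL2P; have f2 := L2repP f; apply: is_L2P.
  exact: cmeasC (is_L2_cmeas f2).
under eq_integral do rewrite abs2C.
by rewrite -nrm2_EFin ltry.
Qed.

Definition expL2 (n : int) : L2 R := toL2 (zpow n).

Lemma expL2E (n : int) : ae_circ (expL2 n) (zpow n).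
Proof. by apply: toL2P; exact: is_L2_zpow. Qed.

(** [fourier] integrates against the function z^n, [ip] against a chosen representative of its
    class, which agrees with it only a.e. *)
Lemma fourierE f (n : int) : fourier f n = ip f (expL2 n).
Proof.
apply: ae_cint.
- exact: cintegrable_mul_conj (L2repP f) (is_L2_zpow R n).
- exact: cintegrable_mul_conj (L2repP f) (L2repP (expL2 n)).
- by apply: ae_onS (expL2E n) => t ->.
Qed.

Lemma bounded_zpow (n : int) : bounded_fun_ae (@zpow R n).
Proof. exact: unimodular_bounded (unimodular_zpow n). Qed.

Lemma bounded_expL2 (n : int) : bounded_fun_ae (expL2 n).
Proof. exact: bounded_fun_ext (bounded_zpow n) (expL2E n). Qed.

Lemma mulL2_expL2 (m n : int) : mulL2 (zpow m) (expL2 n) = expL2 (m + n).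
Proof.
apply: L2_ext; apply: ae_on_mp (mulL2E (expL2 n) (bounded_zpow m)) _.
apply: ae_on_mp (expL2E n) _; apply: ae_on_mp (expL2E (m + n)) _.
by apply: ae_onW => t /= -> -> ->; rewrite zpowD.
Qed.

Lemma mulL2_zpow_adj (m : int) f g :
  ip (mulL2 (zpow m) f) g = ip f (mulL2 (zpow (- m)) g).
Proof.
rewrite mulL2_adj; last exact: bounded_zpow.
by congr ip; congr toL2; apply/funext => t; rewrite zpowN.
Qed.

Lemma mulL2_zpowM (m n : int) f :
  mulL2 (zpow m) (mulL2 (zpow n) f) = mulL2 (zpow (m + n)) f.
Proof.
rewrite mulL2M; try exact: bounded_zpow.
by congr toL2; apply/funext => t; rewrite zpowD.
Qed.

Lemma mulL2_zpow0 f : mulL2 (zpow 0) f = f.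
Proof.
apply: mulL2_1; first exact: bounded_zpow.
by apply: ae_onW => t; rewrite zpow0.
Qed.

Lemma mulL2CA u v f : bounded_fun_ae u -> bounded_fun_ae v ->
  mulL2 u (mulL2 v f) = mulL2 v (mulL2 u f).
Proof.
move=> bu bv; rewrite !mulL2M//.
by congr toL2; apply/funext => t; rewrite (mulrC (u t)).
Qed.

End multiplication.

(** * Completeness *)

Section completeness.
Local Open Scope classical_set_scope.
Local Open Scope complex_scope.
Variable R : realType.
Local Notation mu := (@lebesgue_measure R).
Local Notation D := (circ R).
Implicit Types (f g h : L2 R) (u v : R -> R[i]).

(** The increments form an absolutely convergent series, whose partial sums are the sequence minus
    its first term. *)
Lemma cvgn_bounded_variation (a : nat -> R) (M : R) :
  (forall n, \sum_(0 <= j < n) `|a j.+1 - a j| <= M) -> cvgn a.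
Proof.
move=> aM; have ca : cvgn (series (telescope a)).
  apply: normed_cvg; apply: nondecreasing_is_cvgn.
    apply/nondecreasing_seqP => n /=.
    by rewrite /series /= big_nat_recr//= lerDl.
  by exists M => _ [n _ <-]; exact: aM.
have -> : a = (fun n => a 0%N + series (telescope a) n).
  by apply/funext => n; rewrite -eq_sum_telescope.
by apply: is_cvgD => //; exact: is_cvg_cst.
Qed.

Lemma lebesgue_circ : lebesgue_measure D = 1%E :> \bar R.
Proof. by rewrite /circ lebesgue_measure_itv/= lte_fin ltr01 oppr0 adde0. Qed.

(** The threshold [J] is there because in the Cauchy argument the bound on the integrals holds only
    from some index on. *)
Lemma fatou_le (phi : nat -> R -> \bar R) (psi : R -> \bar R) (c : \bar R) (J : nat) :
  (forall n, measurable_fun D (phi n)) ->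
  (forall n t, D t -> (0 <= phi n t)%E) ->
  (forall n, (J <= n)%N -> (\int[mu]_(t in D) phi n t <= c)%E) ->
  (forall t, D t -> phi ^~ t @ \oo --> psi t) ->
  (\int[mu]_(t in D) psi t <= c)%E.
Proof.
move=> mphi phi0 phic phipsi.
have := @fatou _ (measurableTypeR R) R mu D (@measurable_circ R) phi mphi phi0.
have -> : (\int[mu]_(t in D) psi t =
    \int[mu]_(t in D) limn_einf (phi^~ t))%E.
  apply: eq_integral => t /set_mem Dt.
  by have [->] := cvg_limn_einf_sup (phipsi t Dt).
move=> h; apply: le_trans h _; rewrite limn_einf_lim.
apply: lime_le; first exact: is_cvg_einfs.
exists J => // n /= Jn; apply: le_trans (phic n Jn).
by apply: ereal_inf_lbound; exists n => /=.
Qed.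

Lemma nrm2B_EFin f g :
  (nrm2 (f - g))%:E = (\int[mu]_(t in D) (abs2 (f t - g t))%:E)%E.
Proof.
have [fr fi] := is_L2_cmeas (L2repP f).
have [gr gi] := is_L2_cmeas (L2repP g).
have [dr di] := is_L2_cmeas (L2repP (f - g)).
rewrite nrm2_EFin; apply: (@ae_eq_integral _ (measurableTypeR R)).
- exact: measurable_circ.
- by apply/measurable_EFinP; exact: measurable_abs2.
- apply/measurable_EFinP; apply: measurable_abs2.
    under eq_fun do rewrite ReD raddfN.
    exact: measurable_funB.
  under eq_fun do rewrite ImD raddfN.
  exact: measurable_funB.
- by apply: ae_onS (L2BE f g) => t ->.
Qed.

Lemma ReB (x y : R[i]) : complex.Re (x - y) = complex.Re x - complex.Re y.
Proof. by case: x => ? ?; case: y. Qed.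
Lemma ImB (x y : R[i]) : complex.Im (x - y) = complex.Im x - complex.Im y.
Proof. by case: x => ? ?; case: y. Qed.

(** From c^-1 (|x| - c)^2 >= 0 for each of the two parts. The free weight [c] turns an L2 bound into
    an L1 bound. *)
Lemma norm_ReIm_le (x : R[i]) (c : R) : 0 < c ->
  `|complex.Re x| + `|complex.Im x| <= c + c^-1 * abs2 x.
Proof.
move=> c0; case: x => a b; rewrite /abs2 /= -[a ^+ 2]real_normK ?num_real//.
rewrite -[b ^+ 2]real_normK ?num_real//.
have [ci cic] : 0 < c^-1 /\ c^-1 * c = 1 by rewrite invr_gt0 mulVf ?gt_eqF.
set A := `|a|; set B := `|b|; set d := c^-1 in ci cic *.
have := mulr_ge0 (ltW ci) (sqr_ge0 (A - c)); have := mulr_ge0 (ltW ci) (sqr_ge0 (B - c)).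
have -> : d * (A - c) ^+ 2 = d * A ^+ 2 - 2 * (d * c) * A + (d * c) * c by ring.
have -> : d * (B - c) ^+ 2 = d * B ^+ 2 - 2 * (d * c) * B + (d * c) * c by ring.
have := mulr_ge0 (ltW ci) (sqr_ge0 A); have := mulr_ge0 (ltW ci) (sqr_ge0 B).
rewrite cic; lra.
Qed.

(* The increments of a sequence converging geometrically fast in L2 are summable
   in L1, hence pointwise almost everywhere. *)
Lemma ae_cvg_subseq (g : nat -> L2 R) :
  (forall j, nrm2 (g j.+1 - g j) <= 4^-1 ^+ j) ->
  ae_on (fun t => cvgn (fun j => complex.Re (g j t)) /\
                  cvgn (fun j => complex.Im (g j t))).
Proof.
move=> gj.
pose d (j : nat) (t : R) : R := `|complex.Re (g j.+1 t - g j t)|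
  + `|complex.Im (g j.+1 t - g j t)|.
have d0 j t : 0 <= d j t by rewrite addr_ge0.
have mg j : cmeas (fun t => g j.+1 t - g j t).
  have [r1 i1] := is_L2_cmeas (L2repP (g j.+1)).
  have [r2 i2] := is_L2_cmeas (L2repP (g j)).
  split; first by under eq_fun do rewrite ReB; exact: measurable_funB.
  by under eq_fun do rewrite ImB; exact: measurable_funB.
have md j : measurable_fun D (fun t => (d j t)%:E).
  have [r1 i1] := mg j; apply/measurable_EFinP; apply: measurable_funD.
    exact: measurableT_comp.
  exact: measurableT_comp.
have id j : (\int[mu]_(t in D) (d j t)%:E <= (2 * 2^-1 ^+ j)%:E)%E.
  have [r1 i1] := mg j; have ma := measurable_abs2 r1 i1.
  (* This weight balances the two terms: c + c^-1 4^-j = 2 * 2^-j, which is summable in j. *)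
  pose c : R := 2^-1 ^+ j.
  have c0 : 0 < c by rewrite exprn_gt0.
  apply: (@le_trans _ _ (\int[mu]_(t in D)
      (c%:E + c^-1%:E * (abs2 (g j.+1 t - g j t))%:E))%E).
    apply: ge0_le_integral => //; first exact: measurable_circ.
    - by move=> t _; rewrite lee_fin.
    - exact: md.
    - apply/measurable_EFinP; apply: measurable_funD => //.
      exact: measurable_funM.
    - by move=> t _; rewrite -EFinM -EFinD lee_fin norm_ReIm_le.
  rewrite ge0_integralD//; last 4 first.
  - exact: measurable_circ.
  - by move=> t _; rewrite lee_fin ltW.
  - by move=> t _; rewrite -EFinM lee_fin mulr_ge0 ?invr_ge0 ?(ltW c0) ?abs2_ge0.
  - by apply/measurable_EFinP; apply: measurable_funM.
  have -> : (\int[mu]_(_ in D) c%:E)%E = c%:E.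
    apply: etrans (integral_cst mu (@measurable_circ R) c%:E) _.
    exact: etrans (congr1 (fun x => c%:E * x)%E lebesgue_circ) (mule1 _).
  rewrite ge0_integralZl//; last 4 first.
  - exact: measurable_circ.
  - exact/measurable_EFinP.
  - by move=> t _; rewrite lee_fin abs2_ge0.
  - by rewrite lee_fin invr_ge0 ltW.
  rewrite -nrm2B_EFin.
  rewrite -EFinM -EFinD lee_fin.
  have -> : 2 * 2^-1 ^+ j = c + c by rewrite /c; ring.
  rewrite lerD2l mulrC ler_pdivrMr//; apply: le_trans (gj j) _.
  rewrite -exprMn le_eqVlt; apply/orP; left; apply/eqP; congr (_ ^+ _); lra.
have md0 : measurable_fun D (fun t => \sum_(j <oo) (d j t)%:E)%E.
  by apply: ge0_emeasurable_sum => //; move=> j t _ _; rewrite lee_fin.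
have fin : (\int[mu]_(t in D) (\sum_(j <oo) (d j t)%:E) <= 4%:E)%E.
  rewrite integral_nneseries//; last 2 first.
  - exact: measurable_circ.
  - by move=> j t _; rewrite lee_fin.
  apply: lime_le.
    apply: is_cvg_nneseries => j _ _; apply: integral_ge0 => t _; rewrite lee_fin//.
  apply: nearW => n; apply: (@le_trans _ _ (\sum_(0 <= j < n) (2 * 2^-1 ^+ j)%:E)%E).
    by apply: lee_sum => j _; exact: id.
  rewrite sumEFin lee_fin.
  suff -> : \sum_(0 <= j < n) (2 * 2^-1 ^+ j) = 4 - 4 * 2^-1 ^+ n :> R.
    by rewrite gerBl mulr_ge0// exprn_ge0.
  elim: n => [|n IH]; first by rewrite big_nil expr0 mulr1 subrr.
  rewrite big_nat_recr//= IH exprS; lra.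
have int : mu.-integrable D (fun t => \sum_(j <oo) (d j t)%:E)%E.
  apply/integrableP; split=> //; apply: le_lt_trans (ltry 4).
  apply: le_trans fin; rewrite le_eqVlt; apply/orP; left; apply/eqP.
  apply: eq_integral => t _; rewrite gee0_abs// nneseries_ge0// => j _ _.
  by rewrite lee_fin.
have := @integrable_ae _ (measurableTypeR R) R mu D (@measurable_circ R) _ int.
apply: ae_onS => t /fineK fint.
have bd n : \sum_(0 <= j < n) d j t <= fine (\sum_(j <oo) (d j t)%:E)%E.
  rewrite -lee_fin fint -sumEFin; apply: nneseries_lim_ge => j _ _.
  by rewrite lee_fin.
split; apply: (@cvgn_bounded_variation _ (fine (\sum_(j <oo) (d j t)%:E)%E)) => n;
  apply: le_trans (bd n); apply: ler_sum => j _; rewrite /d ReB ImB.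
  by rewrite lerDl.
by rewrite lerDr.
Qed.

Lemma subseq_cauchy (f_ : nat -> L2 R) :
  (forall eps : R, 0 < eps -> exists N, forall m n,
     (N <= m)%N -> (N <= n)%N -> nrm2 (f_ m - f_ n) < eps) ->
  exists K : nat -> nat, (forall j, (j <= K j)%N) /\
    forall j, nrm2 (f_ (K j.+1) - f_ (K j)) <= 4^-1 ^+ j.
Proof.
move=> cau; have /choice[k kP] : forall j, exists N, forall m n,
    (N <= m)%N -> (N <= n)%N -> nrm2 (f_ m - f_ n) < 4^-1 ^+ j.
  by move=> j; apply: cau; rewrite exprn_gt0.
(* Partial sums of the thresholds, each plus one: nondecreasing, above every [k j], and at least
   j. *)
pose K j := (\sum_(0 <= i < j.+1) (k i).+1)%N.
have kK j : (k j <= K j)%N.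
  by rewrite /K big_nat_recr//= (leq_trans (leqnSn _))// leq_addl.
have KS j : (K j <= K j.+1)%N by rewrite {2}/K big_nat_recr//= leq_addr.
exists K; split=> j.
  elim: j => // j IH; rewrite {1}/K big_nat_recr//=.
  by rewrite (leq_ltn_trans IH)// -[X in (X < _)%N]addn0 ltn_add2l.
by apply/ltW/kP => //; exact: leq_trans (KS j).
Qed.

Lemma L2_complete (f_ : nat -> L2 R) :
  (forall eps : R, 0 < eps -> exists N, forall m n,
     (N <= m)%N -> (N <= n)%N -> nrm2 (f_ m - f_ n) < eps) ->
  exists f, forall eps : R, 0 < eps -> exists N, forall n,
     (N <= n)%N -> nrm2 (f_ n - f) <= eps.
Proof.
move=> cau; have [K [jK gK]] := subseq_cauchy cau.
pose g j := f_ (K j).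
have [N [mN N0 subN]] := ae_cvg_subseq gK.
have cN t : D t -> ~ N t -> cvgn (fun j => complex.Re (g j t)) /\
    cvgn (fun j => complex.Im (g j t)).
  by move=> Dt Nt; apply: contrapT => h; apply: Nt; apply: subN => /(_ Dt).
(* Cutting off the null set makes the sequences converge at every point of the circle, so that the
   limit is measurable. *)
pose I : R -> R := \1_(~` N).
have mI : measurable_fun D I by apply: measurable_indic; exact: measurableC.
have I1 t : ~ N t -> I t = 1 by move=> Nt; rewrite /I indicE mem_set.
have I0 t : N t -> I t = 0 by move=> Nt; rewrite /I indicE memNset//; exact.
pose gr j t := complex.Re (g j t) * I t.
pose gi j t := complex.Im (g j t) * I t.
have cr t : D t -> cvgn (gr^~ t).
  move=> Dt; have [Nt|Nt] := pselect (N t).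
    rewrite (_ : gr^~ t = cst 0); first exact: is_cvg_cst.
    by apply/funext => j; rewrite /gr I0// mulr0.
  have [c _] := cN t Dt Nt; rewrite (_ : gr^~ t = (fun j => complex.Re (g j t)))//.
  by apply/funext => j; rewrite /gr I1// mulr1.
have ci t : D t -> cvgn (gi^~ t).
  move=> Dt; have [Nt|Nt] := pselect (N t).
    rewrite (_ : gi^~ t = cst 0); first exact: is_cvg_cst.
    by apply/funext => j; rewrite /gi I0// mulr0.
  have [_ c] := cN t Dt Nt; rewrite (_ : gi^~ t = (fun j => complex.Im (g j t)))//.
  by apply/funext => j; rewrite /gi I1// mulr1.
pose Fr (t : R) : R := limn (gr^~ t); pose Fi (t : R) : R := limn (gi^~ t).
pose F (t : R) : R[i] := Fr t +i* Fi t.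
have mg j : measurable_fun D (gr j) /\ measurable_fun D (gi j).
  by have [? ?] := is_L2_cmeas (L2repP (g j)); split; apply: measurable_funM.
have mF : cmeas F.
  split; first by apply: (@measurable_fun_cvg _ _ _ _ gr) => [j|]; [by have [] := mg j|exact: cr].
  by apply: (@measurable_fun_cvg _ _ _ _ gi) => [j|]; [by have [] := mg j|exact: ci].
have aeN : ae_on (fun t => ~ N t).
  by exists N; split=> // t /= h; apply: contrapT => Nt; apply: h.
(* Fatou along the subsequence: [g j] is [f_ (K j)] with j <= K j, so the Cauchy bound passes to the
   limit function. *)
have key (eps : R) M m : (forall n, (M <= n)%N -> nrm2 (f_ m - f_ n) <= eps) ->
    (\int[mu]_(t in D) (abs2 (f_ m t - F t))%:E <= eps%:E)%E.
  move=> Mm; have [fr fi] := is_L2_cmeas (L2repP (f_ m)).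
  pose phi j t : \bar R := ((complex.Re (f_ m t) - gr j t) ^+ 2 +
    (complex.Im (f_ m t) - gi j t) ^+ 2)%:E.
  apply: (@fatou_le phi _ _ M).
  - move=> j; have [? ?] := mg j; apply/measurable_EFinP.
    by apply: measurable_funD; apply: measurable_funX; apply: measurable_funB.
  - by move=> j t _; rewrite lee_fin addr_ge0// sqr_ge0.
  - move=> j Mj; have <- : (nrm2 (f_ m - g j))%:E = (\int[mu]_(t in D) phi j t)%E.
      rewrite nrm2B_EFin; have [gr1 gi1] := is_L2_cmeas (L2repP (g j)).
      have [? ?] := mg j.
      apply: (@ae_eq_integral _ (measurableTypeR R)).
      + exact: measurable_circ.
      + apply/measurable_EFinP; apply: measurable_abs2.
          by under eq_fun do rewrite ReB; exact: measurable_funB.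
        by under eq_fun do rewrite ImB; exact: measurable_funB.
      + apply/measurable_EFinP.
        by apply: measurable_funD; apply: measurable_funX; apply: measurable_funB.
      + apply: ae_onS aeN => t Nt.
        by rewrite /phi /abs2 ReB ImB /gr /gi I1// !mulr1.
    by rewrite lee_fin; apply: Mm; exact: leq_trans (jK j).
  - move=> t Dt; rewrite /abs2 ReB ImB; apply: cvg_EFin; first exact: nearW.
    have sq (a : nat -> R) (l : R) : a @ \oo --> l ->
        (fun j => a j ^+ 2) @ \oo --> l ^+ 2 by move=> h; exact: (cvgM h h).
    have hr : (fun j => (complex.Re (f_ m t) - gr j t) ^+ 2) @ \oo -->
        (complex.Re (f_ m t) - Fr t) ^+ 2.
      by apply: sq; apply: cvgB; [exact: cvg_cst|exact: cr].
    have hi : (fun j => (complex.Im (f_ m t) - gi j t) ^+ 2) @ \oo -->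
        (complex.Im (f_ m t) - Fi t) ^+ 2.
      by apply: sq; apply: cvgB; [exact: cvg_cst|exact: ci].
    exact: cvgD hr hi.
have [M0 M0P] := cau 1 ltr01.
have k0 := key 1 M0 M0 (fun n hn => ltW (M0P _ _ (leqnn _) hn)).
(* [F] is not yet known to be square integrable; its difference with one term of the sequence is, by
   [key]. *)
pose w t := f_ M0 t - F t.
have w2 : is_L2 w.
  apply: is_L2P; last exact: le_lt_trans k0 (ltry 1).
  have [fr fi] := is_L2_cmeas (L2repP (f_ M0)); have [Fmr Fmi] := mF.
  split; first by under eq_fun do rewrite ReB; exact: measurable_funB.
  by under eq_fun do rewrite ImB; exact: measurable_funB.
pose f : L2 R := f_ M0 - toL2 w.
have fF : ae_circ f F.
  apply: ae_on_mp (L2BE (f_ M0) (toL2 w)) _; apply: ae_on_mp (toL2P w2) _.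
  by apply: ae_onW => t -> ->; rewrite /w opprB addrC addrNK.
exists f => eps e0; have [M MP] := cau eps e0; exists M => n Mn.
rewrite -lee_fin nrm2B_EFin.
apply: le_trans (key eps M n (fun k hk => ltW (MP _ _ Mn hk))).
have [fr fi] := is_L2_cmeas (L2repP (f_ n)); have [Fmr Fmi] := mF.
have [f'r f'i] := is_L2_cmeas (L2repP f).
rewrite le_eqVlt; apply/orP; left; apply/eqP.
apply: (@ae_eq_integral _ (measurableTypeR R)).
- exact: measurable_circ.
- apply/measurable_EFinP; apply: measurable_abs2.
    by under eq_fun do rewrite ReB; exact: measurable_funB.
  by under eq_fun do rewrite ImB; exact: measurable_funB.
- apply/measurable_EFinP; apply: measurable_abs2.
    by under eq_fun do rewrite ReB; exact: measurable_funB.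
  by under eq_fun do rewrite ImB; exact: measurable_funB.
- by apply: ae_onS fF => t ->.
Qed.

End completeness.

(** * The exponentials *)

Section orthonormality.
Local Open Scope classical_set_scope.
Local Open Scope complex_scope.
Variable R : realType.
Local Notation mu := (@lebesgue_measure R).
Local Notation D := (circ R).
Implicit Types (f g h : L2 R) (u v : R -> R[i]).

Lemma Rintegral_circ_derive (F f : R -> R) :
  (forall x : R, is_derive x (1 : R) F (f x)) -> continuous f ->
  Rintegral mu D f = F 1 - F 0.
Proof.
move=> dF cf; have cF : continuous F.
  move=> x; apply/differentiable_continuous/derivable1_diffP.
  by apply: (@ex_derive _ _ _ _ _ _ (f x)); exact: dF.
rewrite /Rintegral (@continuous_FTC2 R f F 0 1)//.
- exact: continuous_subspaceT.
- split=> [x _| |]; first by apply: (@ex_derive _ _ _ _ _ _ (f x)); exact: dF.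
    exact: cvg_at_right_filter (cF 0).
  exact: cvg_at_left_filter (cF 1).
- by move=> x _; rewrite derive1E; apply: derive_val.
Qed.

Lemma zpow_at1 (n : int) : zpow n (1 : R) = 1.
Proof.
have z1 : zpow 1 (1 : R) = 1.
  by rewrite /zpow !mulr1 [2 * pi]mulr_natl cos2pi sin2pi.
have zn (k : nat) : zpow k%:Z (1 : R) = 1.
  elim: k => [|k IH]; first by rewrite zpow0.
  by rewrite -addn1 PoszD zpowD IH z1 mulr1.
case: n => k //; rewrite NegzE -zpowN zn; exact: rmorph1.
Qed.

Lemma cint_zpow (n : int) : n != 0 -> cint (@zpow R n) = 0.
Proof.
move=> n0; pose c : R := 2 * pi * n%:~R.
have c0 : c != 0.
  by rewrite /c !mulf_eq0 !negb_or pnatr_eq0 (gt_eqF (pi_gt0 R)) intr_eq0.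
have cc : continuous (fun t : R => c * t) by exact: mulrl_continuous.
have ccos : continuous (fun t : R => cos (c * t)).
  by move=> t; apply: continuous_comp; [exact: cc|exact: continuous_cos].
have csin : continuous (fun t : R => sin (c * t)).
  by move=> t; apply: continuous_comp; [exact: cc|exact: continuous_sin].
have dlin (x : R) : is_derive x (1 : R) (fun t : R => c * t) c.
  by apply: is_derive_eq (is_deriveZ c (is_derive_id x 1)) _; rewrite /GRing.scale/= mulr1.
have [c1 s1] : cos c = 1 /\ sin c = 0.
  have /eqP := zpow_at1 n; rewrite /zpow mulr1 -/c eq_complex /=.
  by move=> /andP[/eqP-> /eqP->].
have dsin (x : R) : is_derive x (1 : R) (fun t => c^-1 * sin (c * t)) (cos (c * x)).
  have h := is_deriveZ c^-1 (is_derive1_comp (is_derive_sin (c * x)) (dlin x)).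
  by apply: is_derive_eq h _; rewrite /GRing.scale/=; field.
have dcos (x : R) : is_derive x (1 : R) (fun t => - c^-1 * cos (c * t)) (sin (c * x)).
  have h := is_deriveZ (- c^-1) (is_derive1_comp (is_derive_cos (c * x)) (dlin x)).
  by apply: is_derive_eq h _; rewrite /GRing.scale/=; field.
have icos : Rintegral mu D (fun t => cos (c * t)) = 0.
  by rewrite (Rintegral_circ_derive dsin ccos) mulr1 mulr0 s1 sin0 subrr.
have isin : Rintegral mu D (fun t => sin (c * t)) = 0.
  by rewrite (Rintegral_circ_derive dcos csin) mulr1 mulr0 c1 cos0 subrr.
by rewrite /cint /= icos isin.
Qed.

Lemma cint_zpow0 : cint (@zpow R 0) = 1.
Proof.
have l1 := @lebesgue_circ R.
rewrite /cint; under eq_Rintegral do rewrite zpow0.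
under [X in _ +i* X]eq_Rintegral do rewrite zpow0.
rewrite /= !Rintegral_cst; try exact: measurable_circ.
rewrite mul0r mul1r; congr (_ +i* _).
exact: (congr1 fine l1).
Qed.

Lemma expL2_ortho (m n : int) : ip (expL2 R m) (expL2 R n) = (m == n)%:R.
Proof.
have -> : ip (expL2 R m) (expL2 R n) = cint (@zpow R (m - n)).
  rewrite -fourierE /fourier; apply: ae_cint.
  - exact: cintegrable_mul_conj (L2repP _) (is_L2_zpow R n).
  - rewrite (_ : zpow (m - n) = (fun t : R => zpow m t * (zpow n t)^*%C)).
      exact: cintegrable_mul_conj (is_L2_zpow R m) (is_L2_zpow R n).
    by apply/funext => t; rewrite zpowN -zpowD.
  - by apply: ae_onS (expL2E R m) => t ->; rewrite zpowN -zpowD.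
have [->|mn] := eqVneq m n; first by rewrite subrr cint_zpow0.
by rewrite cint_zpow// subr_eq0.
Qed.

End orthonormality.

(** * Uniqueness of Fourier coefficients *)

Section trigonometric_approximation.
Local Open Scope classical_set_scope.
Local Open Scope complex_scope.
Variable R : realType.
Local Notation mu := (@lebesgue_measure R).
Local Notation D := (circ R).
Implicit Types (f g h : L2 R) (u v : R -> R[i]).

Definition fourier_null f : Prop := forall n, ip f (expL2 R n) = 0.

(* The stable functions form an algebra containing the exponentials, hence all
   trigonometric polynomials. *)
Definition null_stable u : Prop :=
  bounded_fun_ae u /\ forall f, fourier_null f -> fourier_null (mulL2 u f).

Lemma null_stableM u v : null_stable u -> null_stable v ->
  null_stable (fun t => u t * v t).
Proof.
move=> [bu su] [bv sv]; split; first exact: bounded_funM.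
by move=> f f0; rewrite -mulL2M//; apply: su; exact: sv.
Qed.

Lemma null_stable_cst (c : R[i]) : null_stable (cst c).
Proof.
split=> [|f f0 n]; first exact: bounded_fun_cst.
have -> : mulL2 (cst c) f = c *: f.
  apply: L2_ext; apply: ae_on_mp (mulL2E f (bounded_fun_cst c)) _.
  by apply: ae_onS (L2ZE c f) => t -> ->.
by rewrite ipZl f0 mulr0.
Qed.

Lemma null_stableD u v : null_stable u -> null_stable v ->
  null_stable (fun t => u t + v t).
Proof.
move=> [bu su] [bv sv]; have b := bounded_funD bu bv; split=> // f f0 n.
have -> : mulL2 (fun t => u t + v t) f = mulL2 u f + mulL2 v f.
  apply: L2_ext; apply: ae_on_mp (mulL2E f b) _.
  apply: ae_on_mp (mulL2E f bu) _; apply: ae_on_mp (mulL2E f bv) _.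
  by apply: ae_onS (L2DE (mulL2 u f) (mulL2 v f)) => t -> -> -> ->; rewrite mulrDl.
by rewrite ipDl su ?sv ?addr0.
Qed.

Lemma null_stable_zpow (m : int) : null_stable (@zpow R m).
Proof.
split=> [|f f0 n]; first exact: bounded_zpow.
by rewrite mulL2_zpow_adj mulL2_expL2.
Qed.

Lemma null_stableX (q : R -> R) (n : nat) : null_stable (fun t => (q t)%:C) ->
  null_stable (fun t => (q t ^+ n)%:C).
Proof.
move=> sq; elim: n => [|n IH].
  rewrite (_ : (fun _ => _) = cst 1); first exact: null_stable_cst.
  by apply/funext => t; rewrite expr0.
rewrite (_ : (fun _ => _) = (fun t => (q t)%:C * (q t ^+ n)%:C)).
  exact: null_stableM.
by apply/funext => t; rewrite exprS rmorphM.
Qed.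

Lemma null_stable_onem (q : R -> R) : null_stable (fun t => (q t)%:C) ->
  null_stable (fun t => (1 - q t)%:C).
Proof.
move=> sq; rewrite (_ : (fun _ => _) = (fun t => cst 1 t + cst (-1) t * (q t)%:C)).
  apply: null_stableD; first exact: null_stable_cst.
  by apply: null_stableM => //; exact: null_stable_cst.
by apply/funext => t /=; rewrite rmorphB rmorph1 mulN1r.
Qed.

(* A trigonometric polynomial with values in [0, 1] that is below 1/2 exactly on
   the arc ]0, b[, by the product form of the difference of two cosines. *)
Definition arc_fun (b t : R) : R := 2^-1 - sin (pi * t) * sin (pi * (b - t)) / 2.

Lemma null_stable_arc_fun (b : R) : null_stable (fun t => (arc_fun b t)%:C).
Proof.
(* The function is 1/2 + cos(pi b)/4 - cos(2 pi t - pi b)/4, and the last cosine is half of e z +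
   conj(e z) with e = exp(-i pi b); hence the factor -1/8. *)
pose e : R[i] := cos (pi * b) +i* - sin (pi * b).
pose c0 : R[i] := (2^-1 + cos (pi * b) / 4)%:C.
rewrite (_ : (fun _ => _) = (fun t => cst c0 t +
   (cst ((- 8^-1)%:C * e) t * zpow 1 t + cst ((- 8^-1)%:C * e^*%C) t * zpow (-1) t))).
  apply: null_stableD; first exact: null_stable_cst.
  by apply: null_stableD; apply: null_stableM;
    first [exact: null_stable_cst|exact: null_stable_zpow].
apply/funext => t /=; rewrite -zpowN /zpow mulr1 /arc_fun.
have -> : sin (pi * t) * sin (pi * (b - t)) =
    (cos (2 * pi * t) * cos (pi * b) + sin (2 * pi * t) * sin (pi * b)
     - cos (pi * b)) / 2 :> R.
  rewrite -cosB.
  have -> : 2 * pi * t - pi * b = pi * t - pi * (b - t) by ring.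
  have -> : pi * b = pi * t + pi * (b - t) by ring.
  by rewrite cosB cosD; field.
rewrite /e /c0; apply/eqP; rewrite eq_complex; apply/andP; split; apply/eqP.
  by rewrite /=; field.
by rewrite /=; field.
Qed.

Lemma arc_fun_lt (b t : R) : 0 < b < 1 -> 0 < t < 1 -> t < b -> arc_fun b t < 2^-1.
Proof.
move=> /andP[b0 b1] /andP[t0 t1] tb; rewrite /arc_fun gtrBl divr_gt0// mulr_gt0//.
  by apply: sin_gt0_pi; rewrite mulr_gt0 ?pi_gt0//= gtr_pMr ?pi_gt0.
apply: sin_gt0_pi; rewrite mulr_gt0 ?subr_gt0 ?pi_gt0//= gtr_pMr ?pi_gt0//; lra.
Qed.

Lemma arc_fun_gt (b t : R) : 0 < b < 1 -> 0 < t < 1 -> b < t -> 2^-1 < arc_fun b t.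
Proof.
move=> /andP[b0 b1] /andP[t0 t1] bt; rewrite /arc_fun ltrDl oppr_gt0 pmulr_llt0//.
rewrite pmulr_rlt0; last first.
  by apply: sin_gt0_pi; rewrite mulr_gt0 ?pi_gt0//= gtr_pMr ?pi_gt0.
rewrite -[b - t]opprB mulrN sinN oppr_lt0.
apply: sin_gt0_pi; rewrite mulr_gt0 ?subr_gt0 ?pi_gt0//= gtr_pMr ?pi_gt0//; lra.
Qed.

Lemma arc_fun01 (b t : R) : 0 <= arc_fun b t <= 1.
Proof.
have h (x : R) : `|sin x| <= 1 by rewrite ler_norml sin_geN1 sin_le1.
have : `|sin (pi * t) * sin (pi * (b - t))| <= 1 by rewrite normrM mulr_ile1.
by rewrite ler_norml /arc_fun => /andP[? ?]; apply/andP; split; lra.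
Qed.

Lemma bernoulli_onem (a : R) (n : nat) : 0 <= a <= 1 -> 1 - n%:R * a <= (1 - a) ^+ n.
Proof.
move=> /andP[a0 a1]; elim: n => [|n IH]; first by rewrite expr0 mul0r subr0.
rewrite exprS; apply: (@le_trans _ _ ((1 - a) * (1 - n%:R * a))).
  rewrite -subr_ge0 (_ : _ - _ = n%:R * a ^+ 2); last by rewrite -natr1; ring.
  by rewrite mulr_ge0// sqr_ge0.
by rewrite ler_wpM2l// subr_ge0.
Qed.

Lemma bernoulli_onep (a : R) (n : nat) : 0 <= a -> n%:R * a <= (1 + a) ^+ n.
Proof.
move=> a0; suff : 1 + n%:R * a <= (1 + a) ^+ n by apply: le_trans; rewrite lerDr.
elim: n => [|n IH]; first by rewrite expr0 mul0r addr0.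
rewrite exprS; apply: (@le_trans _ _ ((1 + a) * (1 + n%:R * a))).
  rewrite -subr_ge0 (_ : _ - _ = n%:R * a ^+ 2); last by rewrite -natr1; ring.
  by rewrite mulr_ge0// sqr_ge0.
by rewrite ler_wpM2l// addr_ge0.
Qed.

(* These polynomials approximate the indicator of y < 1/2 on [0, 1]. *)
Definition step_poly (k : nat) (y : R) : R := (1 - y ^+ k) ^+ (2 ^ k).

Lemma step_poly01 k (y : R) : 0 <= y <= 1 -> 0 <= step_poly k y <= 1.
Proof.
move=> /andP[y0 y1]; have k0 : 0 <= y ^+ k by rewrite exprn_ge0.
have k1 : y ^+ k <= 1 by rewrite exprn_ile1.
rewrite /step_poly exprn_ge0 ?subr_ge0//= exprn_ile1 ?subr_ge0//.
by rewrite gerBl.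
Qed.

(** Bernoulli gives the lower bound 1 - 2^k y^k = 1 - (2 y)^k: the exponent 2^k is what puts the
    threshold at 1/2. *)
Lemma step_poly_lt (y : R) : 0 <= y -> y < 2^-1 ->
  (step_poly k y) @[k --> \oo] --> (1 : R).
Proof.
move=> y0 y2; have y1 : y <= 1 by lra.
have c : (fun k : nat => 1 - (2 * y) ^+ k) @ \oo --> (1 : R).
  rewrite -[X in _ --> X]subr0; apply: cvgB; first exact: cvg_cst.
  by apply: cvg_expr; rewrite ger0_norm ?mulr_ge0//; lra.
apply: (@squeeze_cvgr _ \oo _ R _ (fun=> 1) _ _ _ c); last exact: cvg_cst.
apply: nearW => k.
have /andP[_ ->] : 0 <= step_poly k y <= 1 by apply: step_poly01; rewrite y0.
rewrite andbT; have := @bernoulli_onem (y ^+ k) (2 ^ k).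
by rewrite natrX -exprMn; apply; rewrite exprn_ge0//= exprn_ile1.
Qed.

(** By Bernoulli (2 y)^k <= (1 + y^k)^(2^k). The product of this power with the step polynomial is
    at most 1, so the polynomial is at most (2 y)^-k. *)
Lemma step_poly_gt (y : R) : y <= 1 -> 2^-1 < y ->
  (step_poly k y) @[k --> \oo] --> (0 : R).
Proof.
move=> y1 y2; have y0 : 0 < y by lra.
have c : (fun k : nat => (2 * y)^-1 ^+ k) @ \oo --> (0 : R).
  apply: cvg_expr; rewrite ger0_norm ?invr_ge0 ?mulr_ge0 ?(ltW y0)//.
  by rewrite invf_lt1 ?mulr_gt0//; lra.
apply: (@squeeze_cvgr _ \oo _ R (fun=> 0) _ _ _ _ _ c); last exact: cvg_cst.
apply: nearW => k.
have /andP[s0 _] : 0 <= step_poly k y <= 1 by apply: step_poly01; rewrite (ltW y0).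
rewrite s0 /= exprVn -[leRHS]mul1r ler_pdivlMr ?exprn_gt0 ?mulr_gt0//.
have k0 : 0 <= y ^+ k by rewrite exprn_ge0// ltW.
have k1 : y ^+ k <= 1 by rewrite exprn_ile1// ltW.
apply: (@le_trans _ _ (step_poly k y * (1 + y ^+ k) ^+ (2 ^ k))).
  by rewrite ler_wpM2l// exprMn -natrX; exact: bernoulli_onep.
rewrite -exprMn exprn_ile1//; first by rewrite mulr_ge0 ?subr_ge0 ?addr_ge0.
rewrite (_ : _ * _ = 1 - y ^+ k ^+ 2); last by ring.
by rewrite gerBl exprn_ge0.
Qed.

End trigonometric_approximation.

(** * A function without Fourier coefficients vanishes *)

Section vanishing_coefficients.
Local Open Scope classical_set_scope.
Local Open Scope complex_scope.
Variable R : realType.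
Local Notation mu := (@lebesgue_measure R).
Local Notation D := (circ R).
Implicit Types (f g h : L2 R) (u v : R -> R[i]).

Lemma cintegrable_is_L2 u : is_L2 u -> cintegrable u.
Proof.
move=> u2; rewrite (_ : u = (fun t => u t * (zpow 0 t)^*%C)).
  exact: cintegrable_mul_conj u2 (is_L2_zpow R 0).
by apply/funext => t; rewrite zpow0 rmorph1 mulr1.
Qed.

Lemma ae_neq (c : R) : ae_on (fun t => t != c).
Proof.
exists [set c]; split=> //; first exact: lebesgue_measure_set1.
by move=> t /= /not_implyP[_ /negP]; rewrite negbK => /eqP.
Qed.

(** The polynomial in [arc_fun] is null-stable, so its product with f has coefficient 0 at frequency
    0, which is its integral. *)
Lemma null_integral_step (b : R) f (k : nat) : fourier_null f ->
  (\int[mu]_(t in D) (step_poly k (arc_fun b t) * complex.Re (f t))%:E = 0)%E.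
Proof.
move=> f0; pose p t := step_poly k (arc_fun b t).
have [bp sp] : null_stable (fun t => (p t)%:C).
  by apply: null_stableX; apply: null_stable_onem; apply: null_stableX;
    exact: null_stable_arc_fun.
have i := cintegrable_is_L2 (is_L2_mul bp (L2repP f)).
have e0 : cint (fun t => (p t)%:C * f t) = 0.
  rewrite -(sp f f0 0) -fourierE; apply: ae_cint => //.
    exact: cintegrable_mul_conj (L2repP _) (is_L2_zpow R 0).
  by apply: ae_onS (mulL2E f bp) => t ->; rewrite zpow0 rmorph1 mulr1.
have E (t : R) : complex.Re ((p t)%:C * f t) = p t * complex.Re (f t).
  by rewrite Defs.ReM /= mul0r subr0.
have ip : mu.-integrable D (fun t => (p t * complex.Re (f t))%:E).
  by case: i => [i _]; under eq_fun do rewrite -E.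
rewrite -[LHS]fineK; last first.
  by apply: integrable_fin_num => //; exact: measurable_circ.
congr EFin; have := congr1 (@complex.Re R) e0; rewrite /cint /= => <-.
by apply: eq_Rintegral => t _; rewrite E.
Qed.

(** Dominated convergence with majorant |Re f|: the step polynomials of [arc_fun] tend a.e. to the
    indicator of the arc. *)
Lemma null_integral_arc (b : R) f : fourier_null f -> 0 < b < 1 ->
  Rintegral mu `[0, b] (fun t => complex.Re (f t)) = 0.
Proof.
move=> f0 b01; have /andP[b0 b1] := b01.
pose g t := complex.Re (f t).
have [ir _] := cintegrable_is_L2 (L2repP f).
have mg : measurable_fun D g by have [] := is_L2_cmeas (L2repP f).
have bD : `[0, b] `<=` D.
  move=> t; rewrite /circ /= !in_itv/= => /andP[-> /= tb].
  by rewrite (le_trans tb)// ltW.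
have mp k : measurable_fun D (fun t => step_poly k (arc_fun b t)).
  have [[m _] _] : null_stable (fun t => (step_poly k (arc_fun b t))%:C).
    by apply: null_stableX; apply: null_stable_onem; apply: null_stableX;
      exact: null_stable_arc_fun.
  by case: m.
have [] := @dominated_convergence _ (measurableTypeR R) R mu D (@measurable_circ R)
  (fun k t => (step_poly k (arc_fun b t) * g t)%:E)
  (fun t => ((g \_ `[0, b]) t)%:E) (fun t => `|(g t)%:E|)%E.
- by move=> k; apply/measurable_EFinP; exact: (measurable_funM (mp k) mg).
- apply/measurable_EFinP; apply/measurable_restrict => //.
    exact: measurable_circ.
  exact: (measurable_funS (@measurable_circ R) (@subIsetl _ _ _) mg).
(* At 0, b and 1 [arc_fun] equals 1/2, the one value where the step polynomials tend neither to 0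
   nor to 1. *)
- have n3 : ae_on (fun t => t != 0 /\ t != 1 /\ t != b).
    by apply: ae_on_mp (ae_neq 0) _; apply: ae_on_mp (ae_neq 1) _;
      apply: ae_onS (ae_neq b).
  have D01 : ae_on D by apply: aeW.
  apply: ae_onS2 n3 D01 => t [t0 [t1 tb]]; rewrite /circ/= in_itv/= => /andP[t0' t1'].
  have t01 : 0 < t < 1 by rewrite !lt_neqAle t0' t1' eq_sym t0 t1.
  have /andP[y0 y1] := arc_fun01 b t.
  apply: cvg_EFin; first exact: nearW.
  rewrite /=; have [tlt|tge] := ltP t b.
    rewrite patchE mem_set/=; last by rewrite in_itv/= t0' ltW.
    rewrite -[X in _ --> X]mul1r; apply: cvgM; last exact: cvg_cst.
    by apply: step_poly_lt => //; exact: arc_fun_lt.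
  have bt : b < t by rewrite lt_neqAle eq_sym tb.
  rewrite patchE memNset/=; last by rewrite in_itv/= t0' /= leNgt bt.
  rewrite -[X in _ --> X](mul0r (g t)); apply: cvgM; last exact: cvg_cst.
  by apply: step_poly_gt => //; exact: arc_fun_gt.
- by apply: integrable_abse.
- apply: aeW => t k Dt; rewrite lee_fin normrM -[leRHS]mul1r ler_wpM2r//.
  by have /andP[? ?] := step_poly01 k (arc_fun01 b t); rewrite ger0_norm.
move=> _ _; under eq_fun do rewrite null_integral_step//.
move=> /(cvg_lim (@ereal_hausdorff R)); rewrite lim_cst; last exact: ereal_hausdorff.
move=> /esym h.
rewrite -(setIidr bD) Rintegral_mkcondr /Rintegral.
by rewrite [X in fine X]h.
Qed.

(** The primitive of Re f vanishes on ]0, 1[, and by Lebesgue differentiation its derivative is Re f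
    a.e. *)
Lemma fourier_null_Re f : fourier_null f -> ae_on (fun t => complex.Re (f t) = 0).
Proof.
move=> f0; pose g : R -> R := (fun t => complex.Re (f t)) \_ D.
have [ir _] := cintegrable_is_L2 (L2repP f).
have ig : mu.-integrable setT (EFin \o g).
  rewrite /g -restrict_EFin; apply/(integrable_mkcond _ _).1 => //.
  exact: measurable_circ.
have gE y : D y -> g y = complex.Re (f y) by move=> Dy; rewrite /g patchE mem_set.
have igS (A : set R) : measurable A -> mu.-integrable A (EFin \o g).
  by move=> mA; apply: integrableS ig.
have := @FTC1 R g (BLeft 0) (fun y => igS _ (measurable_itv _))
  (open_integrable_locally openT ig).
have ne1 : ae_on (fun t : R => t != 0 /\ t != 1).
  by apply: ae_on_mp (ae_neq 0) _; apply: ae_onS (ae_neq 1).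
apply: (@filterS2 _ _ (ae_filter_ringOfSetsType mu)) ne1 => t ne1 H Dt.
have [t0 t1] := ne1 Dt.
have /andP[t0' t1'] : 0 <= t <= 1 by move: Dt; rewrite /circ/= in_itv.
have t01 : 0 < t < 1 by rewrite !lt_neqAle t0' t1' eq_sym t0 t1.
have /andP[tp t1p] := t01.
have [] := H tp.
move=> _; rewrite (gE _ Dt) => <-.
rewrite derive1E.
have F0 : \forall x \near t, Rintegral mu [set` Interval (BLeft 0) (BRight x)] g = cst 0 x.
  near=> x; have x01 : 0 < x < 1.
    by apply/andP; split; near: x; [exact: lt_nbhsr|exact: lt_nbhsl].
  apply: etrans _ (null_integral_arc f0 x01); apply: eq_Rintegral => y /set_mem.
  rewrite /= in_itv/= => /andP[y0 yx]; apply: gE; rewrite /circ/= in_itv/= y0.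
  by move: x01 => /andP[_ x1]; rewrite (le_trans yx) ?ltW.
by rewrite (near_eq_derive _ F0) derive_cst.
Unshelve. all: by end_near. Qed.

Lemma fourier_null_eq0 f : fourier_null f -> f = 0.
Proof.
move=> f0; apply: L2_ext.
(* The real part of -i f is the imaginary part of f. *)
have f0' : fourier_null ((- 'i)%C *: f) by move=> n; rewrite ipZl f0 mulr0.
apply: ae_on_mp (fourier_null_Re f0) _; apply: ae_on_mp (fourier_null_Re f0') _.
apply: ae_on_mp (L2ZE (- 'i)%C f) _; apply: ae_onS (@L2_0E R) => t -> ->.
by case: (f t) => a b; simpc => /= -> ->.
Qed.

End vanishing_coefficients.

(** * Orthonormal expansions and the Hardy space *)

Section orthonormal_series.
Local Open Scope complex_scope.
Variable R : realType.
Implicit Types (f g h x y : L2 R).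

Lemma abs2_small (z : R[i]) (K : R) : 0 <= K ->
  (forall eps : R, 0 < eps -> abs2 z <= eps * K) -> z = 0.
Proof.
move=> K0 H; apply/eqP; rewrite -abs2_eq0 eq_le abs2_ge0 andbT.
apply/ler_addgt0Pr => e e0; rewrite add0r.
have K1 : 0 < K + 1 by rewrite ltr_wpDl.
apply: le_trans (H (e / (K + 1)) _) _; first by rewrite divr_gt0.
by rewrite mulrAC ler_pdivrMr// ler_pM2l// lerDl.
Qed.

Definition L2cvg (s : nat -> L2 R) x : Prop :=
  forall eps : R, 0 < eps -> exists N, forall n, (N <= n)%N -> nrm2 (s n - x) <= eps.

(** The inner products of partial sums met below are constant from some index on, hence a limit
    stated for that case. *)
Lemma ip_limit (s : nat -> L2 R) x y (c : R[i]) (N : nat) : L2cvg s x ->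
  (forall n, (N <= n)%N -> ip (s n) y = c) -> ip x y = c.
Proof.
move=> sx sc; apply/eqP; rewrite -subr_eq0; apply/eqP.
apply: (@abs2_small _ (nrm2 y)); first exact: nrm2_ge0.
move=> eps e0; have [M MP] := sx eps e0.
have := sc (maxn N M) (leq_maxl _ _); move=> <-.
rewrite -ipBl; apply: le_trans (cauchy_schwarz _ _) _.
by rewrite ler_wpM2r ?nrm2_ge0// -nrm2N opprB MP// leq_maxr.
Qed.

Lemma nrm2D_ortho x y : ip x y = 0 -> nrm2 (x + y) = nrm2 x + nrm2 y.
Proof.
move=> xy; rewrite /nrm2 ipDl !ipDr xy (ip_conj x y) xy rmorph0 addr0 add0r.
exact: ReD.
Qed.

Definition orthonormal (v : nat -> L2 R) : Prop :=
  forall i j, ip (v i) (v j) = (i == j)%:R.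

Definition psum (v : nat -> L2 R) f (n : nat) : L2 R :=
  \sum_(0 <= k < n) ip f (v k) *: v k.

Section orthonormal_family.
Variable v : nat -> L2 R.
Hypothesis v1 : orthonormal v.

Lemma ip_basis_sum (a : nat -> R[i]) (m n j : nat) :
  ip (\sum_(m <= k < n) a k *: v k) (v j) = if (m <= j < n)%N then a j else 0.
Proof.
rewrite ip_suml; under eq_bigr do rewrite ipZl v1.
case: ifPn => mj.
  rewrite (bigD1_seq j) /=; [|by rewrite mem_index_iota|exact: iota_uniq].
  by rewrite eqxx mulr1 big1 ?addr0// => i /negbTE ->; rewrite mulr0.
rewrite big_nat big1// => i mi; case: eqVneq => [e|]; last by rewrite mulr0.
by move: mj; rewrite -e mi.
Qed.

Lemma nrm2_basis_sum (a : nat -> R[i]) (m n : nat) :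
  nrm2 (\sum_(m <= k < n) a k *: v k) = \sum_(m <= k < n) abs2 (a k).
Proof.
elim: n => [|n IH].
  by rewrite !big_geq// /nrm2 ip0l.
have [mn|nm] := leqP m n; last first.
  by rewrite !big_geq// /nrm2 ip0l.
rewrite !big_nat_recr//= nrm2D_ortho ?IH.
  by congr (_ + _); rewrite nrm2Z /nrm2 v1 eqxx /= mulr1.
by rewrite ipZr ip_basis_sum ltnn andbF mulr0.
Qed.

Lemma ip_psum f n j : ip (psum v f n) (v j) = if (j < n)%N then ip f (v j) else 0.
Proof. exact: ip_basis_sum. Qed.

Lemma nrm2_psum f n : nrm2 (psum v f n) = \sum_(0 <= k < n) abs2 (ip f (v k)).
Proof. exact: nrm2_basis_sum. Qed.

(** The partial sum is the orthogonal projection onto the span of the first n vectors; this is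
    Pythagoras. *)
Lemma nrm2B_psum f n :
  nrm2 (f - psum v f n) = nrm2 f - \sum_(0 <= k < n) abs2 (ip f (v k)).
Proof.
have o : ip (psum v f n) (f - psum v f n) = 0.
  rewrite {1}/psum ip_suml big_nat big1// => k /andP[_ kn].
  by rewrite ipZl (ip_conj (f - psum v f n)) ipBl ip_psum kn subrr rmorph0 mulr0.
have := nrm2D_ortho o; rewrite addrC addrNK => ->.
by rewrite nrm2_psum addrAC subrr add0r.
Qed.

Lemma bessel f n : \sum_(0 <= k < n) abs2 (ip f (v k)) <= nrm2 f.
Proof. by rewrite -subr_ge0 -nrm2B_psum nrm2_ge0. Qed.

(** The sums of squares increase and are bounded by Bessel; once within [eps] of their supremum they
    vary by less than [eps]. *)
Lemma psum_cauchy f (eps : R) : 0 < eps -> exists N, forall m n,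
  (N <= m)%N -> (N <= n)%N -> nrm2 (psum v f m - psum v f n) < eps.
Proof.
move=> e0; pose s n := \sum_(0 <= k < n) abs2 (ip f (v k)).
have sm m n : (m <= n)%N -> s m <= s n.
  move=> mn; rewrite /s [leRHS](big_cat_nat (n := m))//= lerDl.
  by apply: sumr_ge0 => k _; exact: abs2_ge0.
have s_ub : has_ubound (range s) by exists (nrm2 f) => _ [k _ <-]; exact: bessel.
have s_sup : has_sup (range s) by split=> //; exists (s 0%N); exists 0%N.
have [_ [N _ <-] hN] := sup_adherent e0 s_sup.
have key m n : (N <= m)%N -> (m <= n)%N -> nrm2 (psum v f n - psum v f m) < eps.
  move=> Nm mn; rewrite /psum (big_cat_nat (n := m))//= addrAC subrr add0r nrm2_basis_sum.
  have -> : \sum_(m <= k < n) abs2 (ip f (v k)) = s n - s m.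
    by rewrite /s [X in X - _](big_cat_nat (n := m))//= addrAC subrr add0r.
  have snS : s n <= sup (range s).
    by apply: ub_le_sup => //; exists n.
  have := sm _ _ Nm; lra.
exists N => m n Nm Nn; case/orP: (leq_total m n) => [mn|nm]; last exact: key.
by rewrite -nrm2N opprB; exact: key.
Qed.

Lemma psum_cvg f : exists g, L2cvg (psum v f) g.
Proof. by apply: L2_complete => eps e0; exact: psum_cauchy. Qed.

Lemma psum_limit_coef f g j : L2cvg (psum v f) g -> ip g (v j) = ip f (v j).
Proof.
move=> fg; apply: (@ip_limit _ _ _ _ j.+1 fg) => n jn.
by rewrite ip_psum jn.
Qed.

Lemma psum_limit_ortho f g y : L2cvg (psum v f) g -> (forall j, ip (v j) y = 0) ->
  ip g y = 0.
Proof.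
move=> fg vy; apply: (@ip_limit _ _ _ _ 0%N fg) => n _.
by rewrite /psum ip_suml big1// => k _; rewrite ipZl vy mulr0.
Qed.

End orthonormal_family.

Definition posexp (k : nat) : L2 R := expL2 R k%:Z.
Definition negexp (k : nat) : L2 R := expL2 R (- k%:Z).

Lemma posexp_orthonormal : orthonormal posexp.
Proof. by move=> i j; rewrite /posexp expL2_ortho. Qed.

Lemma negexp_orthonormal : orthonormal negexp.
Proof. by move=> i j; rewrite /negexp expL2_ortho eqr_opp. Qed.

Lemma H2P f : H2 f <-> forall n, n < 0 -> ip f (expL2 R n) = 0.
Proof. by split=> h n n0; [rewrite -fourierE|rewrite fourierE]; exact: h. Qed.

Lemma int_pos_neg (n : int) : (exists k : nat, n = k%:Z) \/ n < 0.
Proof. by case: n => k; [left; exists k|right]. Qed.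

(** The partial sums converge to a function with the coefficients of [f]: the same at the
    frequencies of the family, zero at the others. Uniqueness of coefficients identifies the two. *)
Lemma basis_series (v : nat -> L2 R) f : orthonormal v ->
  (forall n : int, (exists k, v k = expL2 R n) \/
    ip f (expL2 R n) = 0 /\ forall k, ip (v k) (expL2 R n) = 0) ->
  L2cvg (psum v f) f.
Proof.
move=> v1 H; have [g fg] := psum_cvg v1 f.
suff gf : g - f = 0 by move: fg; rewrite (subr0_eq gf).
apply: fourier_null_eq0 => n; rewrite ipBl.
have [[k <-]|[-> vn]] := H n; first by rewrite (psum_limit_coef v1 k fg) subrr.
by rewrite (psum_limit_ortho fg vn) subrr.
Qed.

Lemma H2_series h : H2 h -> L2cvg (psum posexp h) h.
Proof.
move=> /H2P Hh; apply: basis_series; first exact: posexp_orthonormal.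
move=> n; have [[k ->]|n0] := int_pos_neg n; first by left; exists k.
right; split=> [|k]; first exact: Hh.
by rewrite /posexp expL2_ortho; case: eqVneq => // e; move: n0; rewrite -e.
Qed.

Lemma antianalytic_series f : (forall n : int, 0 < n -> ip f (expL2 R n) = 0) ->
  L2cvg (psum negexp f) f.
Proof.
move=> Hf; apply: basis_series; first exact: negexp_orthonormal.
move=> n; have [[k e]|n0] := int_pos_neg (- n).
  by left; exists k; rewrite /negexp -e opprK.
rewrite oppr_lt0 in n0; right; split=> [|k]; first exact: Hf.
by rewrite /negexp expL2_ortho; case: eqVneq => // e; move: n0; rewrite -e oppr_gt0.
Qed.

Lemma H2_ortho f h : (forall k : nat, ip f (posexp k) = 0) -> H2 h -> ip f h = 0.
Proof.
move=> f0 /H2_series hs; rewrite ip_conj (psum_limit_ortho hs) ?rmorph0// => j.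
by rewrite ip_conj f0 rmorph0.
Qed.

Lemma H2_projection f : exists2 p, H2 p & forall h, H2 h -> ip (f - p) h = 0.
Proof.
have [p fp] := psum_cvg posexp_orthonormal f; exists p.
  apply/H2P => n n0; apply: (psum_limit_ortho fp) => k.
  by rewrite /posexp expL2_ortho; case: eqVneq => // e; move: n0; rewrite -e.
move=> h; apply: H2_ortho => k.
by rewrite ipBl (psum_limit_coef posexp_orthonormal k fp) subrr.
Qed.

Lemma H2_linear a f g : H2 f -> H2 g -> H2 (a *: f + g).
Proof.
move=> /H2P Hf /H2P Hg; apply/H2P => n n0.
by rewrite ip_linearl Hf// Hg// mulr0 addr0.
Qed.

Lemma H2D f g : H2 f -> H2 g -> H2 (f + g).
Proof. by move=> Hf Hg; rewrite -[f]scale1r; exact: H2_linear. Qed.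

Lemma H2_0 : H2 (0 : L2 R).
Proof. by apply/H2P => n _; rewrite ip0l. Qed.

Lemma H2Z a f : H2 f -> H2 (a *: f).
Proof. by move=> Hf; rewrite -[_ *: f]addr0; apply: H2_linear => //; exact: H2_0. Qed.

Lemma H2B f g : H2 f -> H2 g -> H2 (f - g).
Proof. by move=> Hf Hg; rewrite -scaleN1r addrC; exact: H2_linear. Qed.

Lemma H2_posexp k : H2 (posexp k).
Proof.
apply/H2P => n n0; rewrite /posexp expL2_ortho.
by case: eqVneq => // e; move: n0; rewrite -e.
Qed.

Lemma H2_sum (I : Type) (r : seq I) (P : pred I) (F : I -> L2 R) :
  (forall i, P i -> H2 (F i)) -> H2 (\sum_(i <- r | P i) F i).
Proof. by move=> HF; apply: big_ind => //; [exact: H2_0|exact: H2D]. Qed.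

Lemma H2_zpow (k : nat) f : H2 f -> H2 (mulL2 (zpow k%:Z) f).
Proof.
move=> /H2P Hf; apply/H2P => n n0; rewrite mulL2_zpow_adj mulL2_expL2 Hf//.
by rewrite addrC subr_lt0; exact: lt_le_trans n0 _.
Qed.

Lemma mulL2_expL2r (u : L2 R) (n : int) : bounded_fun_ae u ->
  mulL2 u (expL2 R n) = mulL2 (zpow n) u.
Proof.
move=> bu; rewrite mulL2C; apply: mulL2_ae; first exact: bounded_expL2.
  exact: bounded_zpow.
exact: expL2E.
Qed.

Lemma mulL2_posexp (u : L2 R) (k : nat) : bounded_fun_ae u ->
  mulL2 u (posexp k) = mulL2 (zpow k%:Z) u.
Proof. exact: mulL2_expL2r. Qed.

(** Instead of multiplying series, [u] is moved across the inner product; [H2_ortho] then reduces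
    [h] to the exponentials z^k, and z^k u has no negative frequency. *)
Lemma H2_mul (u h : L2 R) : bounded_fun_ae u -> H2 u -> H2 h -> H2 (mulL2 u h).
Proof.
move=> bu Hu Hh; apply/H2P => n n0; rewrite mulL2_adj// ip_conj.
rewrite H2_ortho ?rmorph0// => k; rewrite mulL2_adj; last exact: bounded_funC.
under [X in mulL2 X]eq_fun do rewrite conjcK.
rewrite mulL2_posexp// ip_conj.
by have /H2P -> := H2_zpow k Hu; rewrite ?rmorph0.
Qed.

End orthonormal_series.

(** * Model spaces and the compressed shift *)

Section model_space.
Local Open Scope complex_scope.
Variable R : realType.
Variable u : L2 R.
Hypothesis u_inner : inner_function u.
Implicit Types (f g h x y : L2 R) (k : K2 u).

Let bu : bounded_fun_ae u := unimodular_bounded (inner_unimodular u_inner).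
Let Hu : H2 u. Proof. by case: u_inner. Qed.

Lemma K2P f : reflect (H2 f /\ forall h, H2 h -> ip f (mulL2 u h) = 0) (f \in K2pred u).
Proof. exact: asboolP. Qed.

Lemma K2_H2 k : H2 k.
Proof. by have /K2P[] := K2valP k. Qed.

Lemma K2_ortho k h : H2 h -> ip k (mulL2 u h) = 0.
Proof. by have /K2P[_] := K2valP k; apply. Qed.

Lemma K2_ortho_l k h : H2 h -> ip (mulL2 u h) k = 0.
Proof. by move=> Hh; rewrite ip_conj K2_ortho// rmorph0. Qed.

Lemma K2valB (k l : K2 u) : K2val (k - l) = K2val k - K2val l.
Proof. by []. Qed.

Lemma K2_ext (k l : K2 u) : (forall m : K2 u, ip k m = ip l m) -> k = l.
Proof.
move=> H; apply/subr0_eq/val_inj.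
have : K2val (k - l) = 0 by apply: nrm2_eq0; rewrite /nrm2 {1}K2valB ipBl H subrr.
exact.
Qed.

(** [proj_K2] picks from a set that has to be shown nonempty: it contains g - u q, with g the
    projection of f to H^2 and u q that of g to u H^2. *)
Lemma ip_proj_K2 f k : ip (proj_K2 u f) k = ip f k.
Proof.
have [g Hg fg] := H2_projection f.
have [q Hq gq] := H2_projection (mulL2 (fun t => (u t)^*%C) g).
have wK : g - mulL2 u q \in K2pred u.
  apply/K2P; split; first by apply: H2B => //; exact: H2_mul.
  move=> h Hh; rewrite ipBl mulL2_iso; last exact: inner_unimodular.
  have -> : ip g (mulL2 u h) = ip (mulL2 (fun t => (u t)^*%C) g) h.
    by rewrite ip_conj mulL2_adj// -ip_conj.
  by rewrite -ipBl gq.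
have ex : exists w : K2 u, forall k : K2 u, ip (f - K2val w) k = 0.
  exists (MkK2 wK) => l /=; rewrite opprB addrA addrAC ipDl fg; last exact: K2_H2.
  by rewrite K2_ortho_l ?addr0.
have := @xgetPex _ 0 [set w : K2 u | forall k : K2 u, ip (f - K2val w) k = 0]%classic ex k.
by rewrite ipBl => /eqP; rewrite subr_eq0 => /eqP <-.
Qed.

Lemma proj_K2_eq f k : (forall l : K2 u, ip f l = ip k l) -> proj_K2 u f = k.
Proof. by move=> H; apply: K2_ext => l; rewrite ip_proj_K2. Qed.

Lemma inner_expL2 : mulL2 u (posexp R 0) = u.
Proof. by rewrite mulL2_posexp// mulL2_zpow0. Qed.

Lemma K2_ortho_inner k : ip k u = 0.
Proof. by rewrite -{2}inner_expL2 K2_ortho//; exact: H2_posexp. Qed.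

Lemma ip_inner_inner : ip u u = 1.
Proof.
have := mulL2_iso (posexp R 0) (posexp R 0) (inner_unimodular u_inner).
rewrite inner_expL2 => ->; exact: (posexp_orthonormal R 0 0).
Qed.

Lemma H2_decomp h : H2 h -> exists2 h1, H2 h1 &
  h = ip h (posexp R 0) *: posexp R 0 + mulL2 (zpow 1) h1.
Proof.
move=> Hh; exists (mulL2 (zpow (-1)) (h - ip h (posexp R 0) *: posexp R 0)).
  apply/H2P => n n0; rewrite mulL2_zpow_adj mulL2_expL2 ipBl ipZl.
  have [n1|n1] := eqVneq n (-1).
    by rewrite n1 addrN (posexp_orthonormal R 0 0) mulr1 subrr.
  have n2 : - - 1 + n < 0 by lia.
  have /H2P -> // := Hh; have /H2P -> // := @H2_posexp R 0.
  by rewrite mulr0 subrr.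
by rewrite mulL2_zpowM subrr mulL2_zpow0 addrC subrK.
Qed.

Lemma ip_zpow_inner h : H2 h -> ip u (mulL2 u (mulL2 (zpow 1) h)) = 0.
Proof.
move=> /H2P Hh; rewrite -{1}inner_expL2 mulL2_iso; last exact: inner_unimodular.
rewrite ip_conj mulL2_zpow_adj [X in ip h X]mulL2_expL2 Hh ?rmorph0//.
Qed.

Lemma ktilde0E : ktilde0 u = mulL2 (zpow (-1)) (u - fourier u 0 *: posexp R 0).
Proof.
set c := fourier u 0.
have v2 : is_L2 (fun t => (zpow 1 t)^*%C * (u t - c)).
  have -> : (fun t => (zpow 1 t)^*%C * (u t - c)) =
      (fun t => zpow (-1) t * (u t + cst (-c) t)).
    by apply/funext => t; rewrite zpowN.
  apply: is_L2_mul; first exact: bounded_zpow.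
  have -> : (fun t => u t + cst (- c) t) = (fun t => (u t + cst (- c) t) * zpow 0 t).
    by apply/funext => t; rewrite zpow0 mulr1.
  apply: is_L2_mul; last exact: is_L2_zpow.
  by apply: bounded_funD => //; exact: bounded_fun_cst.
apply: L2_ext; apply: ae_on_mp (toL2P v2) _.
apply: ae_on_mp (mulL2E (u - c *: posexp R 0) (@bounded_zpow R (-1))) _.
apply: ae_on_mp (L2BE u (c *: posexp R 0)) _.
apply: ae_on_mp (L2ZE c (posexp R 0)) _.
apply: ae_onS (expL2E R 0) => t.
by rewrite /ktilde0 -/c => -> -> -> -> ->; rewrite zpowN zpow0 mulr1.
Qed.

(** The constant u(0) in [ktilde0] drops out because z k vanishes at the origin. *)
Lemma ip_ktilde0 k : ip k (ktilde0 u) = ip (mulL2 (zpow 1) k) u.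
Proof.
rewrite ktilde0E -(mulL2_zpow_adj 1) ipBr ipZr.
have -> : ip (mulL2 (zpow 1) k) (posexp R 0) = 0; last by rewrite mulr0 subr0.
by rewrite mulL2_zpow_adj mulL2_expL2; have /H2P -> := K2_H2 k.
Qed.

(** The case f = u puts [ktilde0] in the model space; the other case provides the adjoint of the
    compressed shift. Both rest on <f, u z h> = 0 for h in H^2. *)
Lemma K2_backward_shift f : f \in K2pred u \/ f = u ->
  mulL2 (zpow (-1)) (f - ip f (posexp R 0) *: posexp R 0) \in K2pred u.
Proof.
move=> fu; have Hf : H2 f by case: fu => [/K2P[]//|->].
apply/K2P; split.
  apply/H2P => n n0; rewrite mulL2_zpow_adj mulL2_expL2 ipBl ipZl.
  have [n1|n1] := eqVneq n (-1).
    by rewrite n1 addrN (posexp_orthonormal R 0 0) mulr1 subrr.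
  have n2 : - - 1 + n < 0 by lia.
  have /H2P -> // := Hf; have /H2P -> // := @H2_posexp R 0.
  by rewrite mulr0 subrr.
move=> h Hh; rewrite mulL2_zpow_adj ipBl ipZl.
have -> : ip (posexp R 0) (mulL2 (zpow (- -1)) (mulL2 u h)) = 0.
  have /H2P Huh := H2_mul bu Hu Hh.
  by rewrite ip_conj mulL2_zpow_adj [X in ip _ X]mulL2_expL2 Huh ?rmorph0.
rewrite mulr0 subr0 opprK mulL2CA//; last exact: bounded_zpow.
case: fu => [/K2P[_ ->]//|->]; first exact: (H2_zpow 1).
exact: ip_zpow_inner.
Qed.

Lemma ktilde0_in : ktilde0 u \in K2pred u.
Proof. by rewrite ktilde0E fourierE; apply: K2_backward_shift; right. Qed.

(** z k is in H^2 and orthogonal to u z H^2, so only its component along u, with coefficient <z k,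
    u> = <k, ktilde_u>, has to be removed. *)
Lemma compressed_shiftE k :
  K2val (compressed_shift k) = mulL2 (zpow 1) k - ip k (ktilde0 u) *: u.
Proof.
have wK : mulL2 (zpow 1) k - ip k (ktilde0 u) *: u \in K2pred u.
  apply/K2P; split; first by apply: H2B; [exact: (H2_zpow 1 (K2_H2 k))|exact: H2Z].
  move=> h /H2_decomp[h1 Hh1 ->]; set c := ip h _.
  rewrite mulL2D// mulL2Z// inner_expL2 ipDr ipZr !(ipBl, ipZl) ip_inner_inner.
  rewrite ip_zpow_inner// mulr0 subr0 ip_ktilde0 mulr1 subrr mulr0 add0r.
  rewrite mulL2CA//; last exact: bounded_zpow.
  by rewrite mulL2_iso ?K2_ortho//; exact: unimodular_zpow.
rewrite -[RHS]/(K2val (MkK2 wK)); congr K2val; apply: proj_K2_eq => l /=.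
by rewrite ipBl ipZl (ip_conj l u) K2_ortho_inner rmorph0 mulr0 subr0.
Qed.

(** The backward shift f -> conj(z) (f - f(0)) supplies the element that [adjoint_op] looks for. *)
Lemma ip_adjoint_shift k l :
  ip k (adjoint_op (@compressed_shift R u) l) = ip (compressed_shift k) l.
Proof.
pose h : K2 u := MkK2 (K2_backward_shift (or_introl (K2valP l))).
have ex : exists h : K2 u, forall f : K2 u, ip (compressed_shift f) l = ip f h.
  exists h => f; rewrite compressed_shiftE ipBl ipZl (ip_conj l u) K2_ortho_inner.
  rewrite rmorph0 mulr0 subr0 /h /= -(mulL2_zpow_adj 1) ipBr ipZr.
  have -> : ip (mulL2 (zpow 1) f) (posexp R 0) = 0; last by rewrite mulr0 subr0.
  by rewrite mulL2_zpow_adj mulL2_expL2; have /H2P -> := K2_H2 f.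
have := @xgetPex _ 0
  [set h : K2 u | forall f : K2 u, ip (compressed_shift f) l = ip f h]%classic ex k.
by move=> ->.
Qed.

(** The hypothesis makes [k] the projection of [f], so f - k is orthogonal to k. *)
Lemma nrm2_proj_le f k : (forall l : K2 u, ip f l = ip k l) -> nrm2 k <= nrm2 f.
Proof.
move=> H; have o : ip k (f - K2val k) = 0.
  by rewrite ipBr (ip_conj f k) H ip_self conjc_real subrr.
by have := nrm2D_ortho o; rewrite addrC addrNK => ->; rewrite lerDl nrm2_ge0.
Qed.

(* The projection of z^n onto the model space, which is z^n - u p with p a
   trigonometric polynomial. *)
Lemma K2_exp_bounded (n : nat) : exists w : K2 u, bounded_fun_ae w /\
  forall l : K2 u, ip (posexp R n) l = ip w l.
Proof.
pose q := mulL2 (fun t => (u t)^*%C) (posexp R n).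
pose p : L2 R := \sum_(0 <= j < n.+1) ip q (posexp R j) *: posexp R j.
have Hp : H2 p by apply: H2_sum => j _; apply: H2Z; exact: H2_posexp.
have bp : bounded_fun_ae p by apply: bounded_fun_sum => j; exact: bounded_expL2.
have qp : forall h, H2 h -> ip (q - p) h = 0.
  move=> h; apply: H2_ortho => j; rewrite ipBl (ip_basis_sum (posexp_orthonormal R)).
  rewrite leq0n /= ltnS; case: leqP => [_|nj]; first by rewrite subrr.
  rewrite subr0 /q mulL2_adj; last exact: bounded_funC.
  rewrite (_ : (fun t => _) = u); last by apply/funext => t; rewrite conjcK.
  rewrite mulL2_posexp// ip_conj mulL2_zpow_adj mulL2_expL2.
  have /H2P -> := Hu; first exact: rmorph0.
  by rewrite addrC subr_lt0.
have wK : posexp R n - mulL2 u p \in K2pred u.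
  apply/K2P; split; first by apply: H2B; [exact: H2_posexp|exact: H2_mul].
  move=> h Hh; rewrite ipBl mulL2_iso; last exact: inner_unimodular.
  have -> : ip (posexp R n) (mulL2 u h) = ip q h.
    by rewrite ip_conj mulL2_adj// -ip_conj.
  by rewrite -ipBl qp.
exists (MkK2 wK); split=> [|l /=]; last by rewrite ipBl K2_ortho_l// subr0.
have b := bounded_funD (bounded_expL2 R n)
  (bounded_funM (bounded_fun_cst (-1 : R[i])) (bounded_funM bu bp)).
apply: bounded_fun_ext b _ => /=; apply: ae_on_mp (mulL2E p bu) _.
by apply: ae_onS (L2BE (posexp R n) (mulL2 u p)) => t -> ->; rewrite mulN1r.
Qed.

(** Partial Fourier sums of k approximate it but leave the model space; projecting them back does
    not increase the distance to k and yields bounded functions. *)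
Lemma K2_dense_bounded k (eps : R) : 0 < eps ->
  exists2 l : K2 u, bounded_fun_ae l & nrm2 (k - l) <= eps.
Proof.
move=> e0; have [N /(_ N (leqnn N)) kN] := H2_series (K2_H2 k) e0.
have [w wP] := choice K2_exp_bounded.
pose l : K2 u := \sum_(0 <= j < N) ip k (posexp R j) *: w j.
have lE : K2val l = \sum_(0 <= j < N) ip k (posexp R j) *: K2val (w j).
  by rewrite /l; apply: (big_morph (@K2val R u)).
exists l.
  by rewrite lE; apply: bounded_fun_sum => j; exact: (wP j).1.
rewrite -nrm2N opprB in kN; apply: le_trans kN.
apply: (@nrm2_proj_le _ (k - l)) => m; rewrite K2valB !ipBl; congr (_ - _).
rewrite lE /psum !ip_suml; apply: eq_bigr => j _.
by rewrite !ipZl (wP j).2.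
Qed.

(** L k = L (k - l) for a bounded l as close to k as desired. *)
Lemma K2_bounded_ext (L : K2 u -> R[i]) (C : R) : 0 <= C ->
  (forall k l : K2 u, L (k - l) = L k - L l) ->
  (forall k : K2 u, abs2 (L k) <= C * nrm2 k) ->
  (forall k : K2 u, bounded_fun_ae k -> L k = 0) -> forall k, L k = 0.
Proof.
move=> C0 LB LC L0 k; apply: (abs2_small C0) => eps e0.
have [l bl kl] := K2_dense_bounded k e0.
rewrite -[L k]subr0 -(L0 l bl) -LB mulrC.
by apply: le_trans (LC _) _; rewrite ler_wpM2l.
Qed.

End model_space.

(** * Iterates of the compressed shift *)

Section shift_iterates.
Local Open Scope complex_scope.
Variable R : realType.
Variable u : L2 R.
Hypothesis u_inner : inner_function u.
Implicit Types (f g h x y : L2 R) (k l : K2 u).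
Local Notation S := (@compressed_shift R u).

Let uu := inner_unimodular u_inner.
Let bu : bounded_fun_ae u := unimodular_bounded uu.
Let Hu : H2 u. Proof. by case: u_inner. Qed.

Lemma nrm2_mulL2 (v : R -> R[i]) f : unimodular v -> nrm2 (mulL2 v f) = nrm2 f.
Proof. by move=> vv; rewrite /nrm2 mulL2_iso. Qed.

Lemma compressed_shiftB k l : S (k - l) = S k - S l.
Proof.
have E : K2val (S (k - l)) = K2val (S k) - K2val (S l).
  apply: etrans (compressed_shiftE u_inner (k - l)) _.
  apply: etrans _ (esym (congr2 (fun x y => x - y)
    (compressed_shiftE u_inner k) (compressed_shiftE u_inner l))).
  rewrite (K2valB k l) ipBl scalerBl mulL2B; last exact: bounded_zpow.
  by rewrite !opprD !opprK addrACA.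
by apply: val_inj; exact: E.
Qed.

(** Pythagoras for z k = S k + <k, ktilde_u> u, multiplication by z being isometric. *)
Lemma nrm2_shift k : nrm2 (S k) = nrm2 k - abs2 (ip k (ktilde0 u)).
Proof.
have o : ip (S k) (ip k (ktilde0 u) *: u) = 0 by rewrite ipZr K2_ortho_inner// mulr0.
have := nrm2D_ortho o; rewrite compressed_shiftE// addrNK nrm2_mulL2; last exact: unimodular_zpow.
rewrite nrm2Z {3}/nrm2 ip_inner_inner// mulr1 => ->.
by rewrite addrK.
Qed.

Lemma nrm2_shift_le k : nrm2 (S k) <= nrm2 k.
Proof. by rewrite nrm2_shift gerBl abs2_ge0. Qed.

Lemma nrm2_shift_iter_le k (n : nat) : nrm2 (iter n S k) <= nrm2 k.
Proof. by elim: n => // n IH; exact: le_trans (nrm2_shift_le _) IH. Qed.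

Lemma bounded_shift k : bounded_fun_ae k -> bounded_fun_ae (S k).
Proof.
move=> bk; set c := ip k (ktilde0 u).
have b := bounded_funD (bounded_funM (bounded_zpow R 1) bk)
  (bounded_funM (bounded_fun_cst (- c)) bu).
apply: bounded_fun_ext b _; rewrite compressed_shiftE//.
apply: ae_on_mp (mulL2E k (bounded_zpow R 1)) _; apply: ae_on_mp (L2ZE c u) _.
by apply: ae_onS (L2BE (mulL2 (zpow 1) k) (c *: u)) => t -> -> ->; rewrite mulNr.
Qed.

(** The corrections made at each step stay in u H^2, which is orthogonal to the model space; so
    under the inner product S^n acts as z^n. *)
Lemma shift_iter k (n : nat) : exists2 q, H2 q &
  K2val (iter n S k) = mulL2 (zpow n%:Z) k - mulL2 u q.
Proof.
elim: n => [|n [q Hq IH]].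
  exists 0; first exact: H2_0.
  by rewrite mulL2_zpow0 mulL2_0// subr0.
exists (mulL2 (zpow 1) q + ip (iter n S k) (ktilde0 u) *: posexp R 0).
  by apply: H2D; [exact: (H2_zpow 1)|apply: H2Z; exact: H2_posexp].
rewrite iterS compressed_shiftE// {1}IH mulL2B; last exact: bounded_zpow.
rewrite mulL2_zpowM -PoszD add1n mulL2D// mulL2Z// inner_expL2// opprD addrA.
by rewrite (mulL2CA _ bu (bounded_zpow R 1)).
Qed.

Lemma ip_shift_iter k l (n : nat) : ip (iter n S k) l = ip (mulL2 (zpow n%:Z) k) l.
Proof.
have [q Hq ->] := shift_iter k n.
by rewrite ipBl K2_ortho_l// subr0.
Qed.

(** The complex conjugate of u conj(z k), the image of k under the natural conjugation of the model
    space. *)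
Definition tail_symbol k : L2 R := mulL2 (zpow 1) (mulL2 (fun t => (u t)^*%C) k).

Lemma ip_tail_symbol k (n : int) :
  ip (tail_symbol k) (expL2 R n) = ip k (mulL2 u (expL2 R (n - 1))).
Proof.
rewrite /tail_symbol mulL2_zpow_adj mulL2_expL2 addrC ip_conj -mulL2_adj// -ip_conj.
by [].
Qed.

Lemma tail_symbol_series k : L2cvg (psum (negexp R) (tail_symbol k)) (tail_symbol k).
Proof.
apply: antianalytic_series => n n0; rewrite ip_tail_symbol.
have -> : n - 1 = `|(n - 1)%R|%N%:Z by lia.
by rewrite K2_ortho//; exact: H2_posexp.
Qed.

(** Both sides equal <z^(n+1) k, u>; on the left u(0) drops out since z^(n+1) k vanishes at the
    origin. *)
Lemma ip_shift_iter_ktilde0 k (n : nat) :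
  ip (iter n S k) (ktilde0 u) = ip (tail_symbol k) (negexp R n).
Proof.
rewrite (ip_shift_iter k (MkK2 (ktilde0_in u_inner))) /= ip_tail_symbol ktilde0E//.
rewrite -(mulL2_zpow_adj 1) mulL2_zpowM ipBr ipZr.
have -> : ip (mulL2 (zpow (1 + n)) k) (posexp R 0) = 0.
  by rewrite mulL2_zpow_adj mulL2_expL2; have /H2P -> := K2_H2 k.
rewrite mulr0 subr0 mulL2_zpow_adj; congr ip.
rewrite mulL2_expL2r//.
by congr mulL2; congr zpow; rewrite opprD addrC.

Qed.

(** Both sides lose the same square at each step. In this form the decay of the iterates is the
    convergence in [tail_symbol_series]. *)
Lemma nrm2_shift_iter k (n : nat) :
  nrm2 (iter n S k) = nrm2 (tail_symbol k - psum (negexp R) (tail_symbol k) n).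
Proof.
rewrite nrm2B_psum; last exact: negexp_orthonormal.
have -> : nrm2 (tail_symbol k) = nrm2 k.
  by rewrite !nrm2_mulL2//; [exact: unimodularC|exact: unimodular_zpow].
elim: n => [|n IH]; first by rewrite big_geq// subr0.
rewrite iterS nrm2_shift IH ip_shift_iter_ktilde0 big_nat_recr// [in RHS]opprD.
by rewrite [in RHS]addrA.
Qed.

End shift_iterates.

(** * The characterization *)

Section bounded_functionals.
Local Open Scope complex_scope.
Variable R : realType.
Variable u : L2 R.
Hypothesis u_inner : inner_function u.
Implicit Types (k l : K2 u) (L M : K2 u -> R[i]).

Definition bounded_functional L : Prop :=
  (forall k l, L (k - l) = L k - L l) /\
  exists2 C : R, 0 <= C & forall k, abs2 (L k) <= C * nrm2 k.

Lemma bounded_functionalB L M : bounded_functional L -> bounded_functional M ->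
  bounded_functional (fun k => L k - M k).
Proof.
move=> [LB [C C0 LC]] [MB [E E0 ME]]; split=> [k l|].
  by rewrite LB MB !opprD !opprK addrACA.
exists (2 * C + 2 * E) => [|k]; first by rewrite addr_ge0// mulr_ge0.
apply: le_trans (abs2D _ _) _; rewrite abs2N.
rewrite [leRHS](_ : _ = 2 * (C * nrm2 k) + 2 * (E * nrm2 k)); last by ring.
by rewrite lerD// ler_pM2l.
Qed.

Lemma bounded_functionalZ (a : R[i]) L : bounded_functional L ->
  bounded_functional (fun k => L k * a).
Proof.
move=> [LB [C C0 LC]]; split=> [k l|]; first by rewrite LB mulrBl.
exists (C * abs2 a) => [|k]; first by rewrite mulr_ge0// abs2_ge0.
by rewrite abs2M mulrAC ler_wpM2r// abs2_ge0.
Qed.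

Lemma bounded_functional_ip (v : L2 R) (T : K2 u -> K2 v) (x : L2 R) (C : R) :
  0 <= C -> (forall k l, T (k - l) = T k - T l) ->
  (forall k, nrm2 (T k) <= C * nrm2 k) ->
  bounded_functional (fun k => ip (T k) x).
Proof.
move=> C0 TB TC; split=> [k l|]; first by rewrite TB (K2valB (T k) (T l)) ipBl.
exists (C * nrm2 x) => [|k]; first by rewrite mulr_ge0// nrm2_ge0.
apply: le_trans (cauchy_schwarz _ _) _.
by rewrite mulrAC ler_wpM2r// nrm2_ge0.
Qed.

Lemma bounded_functional_ipl (x : L2 R) : bounded_functional (fun k => ip k x).
Proof.
by apply: (@bounded_functional_ip u id x 1) => // k; rewrite mul1r.
Qed.

Lemma bounded_functional_eq L M : bounded_functional L -> bounded_functional M ->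
  (forall k, bounded_fun_ae k -> L k = M k) -> forall k, L k = M k.
Proof.
move=> bL bM LM k; apply/eqP; rewrite -subr_eq0; apply/eqP.
have [BB [C C0 BC]] := bounded_functionalB bL bM.
apply: (K2_bounded_ext u_inner C0 BB BC) => l bl.
by rewrite LM// subrr.
Qed.

End bounded_functionals.

(** * The operator equation in weak form *)

Section characterization.
Local Open Scope complex_scope.
Variable R : realType.
Variables alpha theta : L2 R.
Hypothesis alpha_inner : inner_function alpha.
Hypothesis theta_inner : inner_function theta.
Variable A : {linear K2 theta -> K2 alpha}.
Hypothesis A_bounded : bounded_op A.
Local Notation St := (@compressed_shift R theta).
Local Notation Sa := (@compressed_shift R alpha).

Let ba : bounded_fun_ae alpha := unimodular_bounded (inner_unimodular alpha_inner).
Let bt : bounded_fun_ae theta := unimodular_bounded (inner_unimodular theta_inner).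

Lemma bounded_op_nrm2 : exists2 C : R, 0 <= C & forall k, nrm2 (A k) <= C * nrm2 k.
Proof.
have [c Ac] := A_bounded; exists (c ^+ 2) => [|k]; first exact: sqr_ge0.
have := Ac k; rewrite /L2norm -/(nrm2 (A k)) -/(nrm2 k) => h.
rewrite -[leLHS]sqr_sqrtr ?nrm2_ge0// -[X in _ * X]sqr_sqrtr ?nrm2_ge0// -exprMn.
by rewrite ler_sqr// nnegrE ?sqrtr_ge0// (le_trans _ h)// sqrtr_ge0.
Qed.

Lemma bounded_functional_A x : bounded_functional (fun k => ip (A k) x).
Proof.
have [C C0 AC] := bounded_op_nrm2.
by apply: (bounded_functional_ip _ C0) => // k l; exact: raddfB.
Qed.

Lemma bounded_functional_AS x : bounded_functional (fun k => ip (A (St k)) x).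
Proof.
have [C C0 AC] := bounded_op_nrm2.
apply: (@bounded_functional_ip _ _ _ (fun k => A (St k)) _ _ C0) => [k l|k].
  by rewrite compressed_shiftB// raddfB.
by apply: le_trans (AC _) _; rewrite ler_wpM2l// nrm2_shift_le.
Qed.

Lemma ip_shift_difference (f : K2 theta) (g : K2 alpha) :
  ip (A f - adjoint_op Sa (A (St f)) : K2 alpha) g =
  ip (A f) g - ip (A (St f)) (Sa g).
Proof.
rewrite (K2valB (A f)) ipBl; congr (_ - _).
by rewrite ip_conj ip_adjoint_shift// -ip_conj.
Qed.

(* The operator equation of the theorem, tested against g. *)
Definition weak_equation (mu : K2 alpha) (nu : K2 theta) : Prop :=
  forall f (g : K2 alpha), ip (A f) g - ip (A (St f)) (Sa g) =
    ip f (ktilde0 theta) * ip mu g + ip f nu * ip (ktilde0 alpha) g.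

Lemma weak_equationP mu nu : weak_equation mu nu <->
  forall f : K2 theta, K2val (A f - adjoint_op Sa (A (St f))) =
    rank_one mu (ktilde0 theta) f + rank_one (ktilde0 alpha) nu f.
Proof.
split=> H f.
  (* [ktilde0 alpha] is wrapped as an element of the model space, so that both sides can be compared
     by testing there. *)
  pose ka : K2 alpha := MkK2 (ktilde0_in alpha_inner).
  have -> : A f - adjoint_op Sa (A (St f)) =
      ip f (ktilde0 theta) *: mu + ip f nu *: ka.
    apply: K2_ext => g; rewrite ip_shift_difference H.
    transitivity (ip (ip f (ktilde0 theta) *: K2val mu + ip f nu *: K2val ka) g) => //.
    by rewrite ipDl !ipZl.
  by [].
by move=> g; rewrite -ip_shift_difference H /rank_one ipDl !ipZl.
Qed.

(** * From a symbol to the equation *)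

Section necessity.
Variable phi : L2 R.
Hypothesis A_phi : forall f : K2 theta, Adom phi f -> A f = Atrunc alpha phi f.

Lemma Adom_bounded (f : K2 theta) : bounded_fun_ae f -> Adom phi f.
Proof.
move=> bf; rewrite /Adom/= (_ : (fun t => _) = (fun t => f t * phi t)).
  exact: is_L2_mul (L2repP phi).
by apply/funext => t; rewrite mulrC.
Qed.

Lemma ip_symbol (f : K2 theta) (g : K2 alpha) : bounded_fun_ae f ->
  ip (A f) g = ip (mulL2 f phi) g.
Proof.
move=> bf; apply: etrans (congr1 (fun x : K2 alpha => ip x g) (A_phi (Adom_bounded bf))) _.
apply: etrans (ip_proj_K2 alpha_inner _ g) _.
by rewrite -/(mulL2 phi f) mulL2C.
Qed.

Lemma mulL2_shift_symbol (f : K2 theta) : bounded_fun_ae f ->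
  mulL2 (St f) phi =
  mulL2 (zpow 1) (mulL2 f phi) - ip f (ktilde0 theta) *: mulL2 theta phi.
Proof.
move=> bf; have bSf := bounded_shift theta_inner bf; set c := ip f _.
apply: L2_ext; apply: ae_on_mp (mulL2E phi bf) _.
apply: ae_on_mp (mulL2E (mulL2 f phi) (bounded_zpow R 1)) _.
apply: ae_on_mp (mulL2E phi bt) _.
apply: ae_on_mp (L2ZE c (mulL2 theta phi)) _.
apply: ae_on_mp (L2BE (mulL2 (zpow 1) (mulL2 f phi)) (c *: mulL2 theta phi)) _.
apply: ae_on_mp (mulL2E f (bounded_zpow R 1)) _.
apply: ae_on_mp (L2ZE c theta) _.
apply: ae_on_mp (L2BE (mulL2 (zpow 1) f) (c *: theta)) _.
apply: ae_on_mp (L2_ae (compressed_shiftE theta_inner f)) _.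
apply: ae_onS (mulL2E phi bSf) => t.
by move=> -> -> -> -> -> -> -> -> -> ->; ring.
Qed.

(** For bounded f, expand <phi S f, S g> with S f = z f - a theta and S g = z g - b alpha. The
    pairing of z f with z g cancels against <A f, g>; the theta term, with S g kept whole, gives
    [mu], and z f against alpha gives [nu]. *)
Lemma symbol_weak_equation :
  weak_equation (adjoint_op Sa (proj_K2 alpha (mulL2 theta phi)))
    (proj_K2 theta (mulL2 (zpow (-1)) (mulL2 alpha (conjL2 phi)))).
Proof.
move=> f g; set mu := adjoint_op _ _; set nu := proj_K2 theta _.
(* Written as a difference to match [bounded_functionalB]; the sign is undone below. *)
pose rhs (f : K2 theta) := ip f (ktilde0 theta) * ip mu g -
  ip f nu * - ip (ktilde0 alpha) g.
suff : ip (A f) g - ip (A (St f)) (Sa g) = rhs f by rewrite /rhs mulrN opprK.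
move: f; apply: (bounded_functional_eq theta_inner).
- by apply: bounded_functionalB; [exact: bounded_functional_A|exact: bounded_functional_AS].
- by apply: bounded_functionalB; apply: bounded_functionalZ; exact: bounded_functional_ipl.
move=> f bf; rewrite /rhs mulrN opprK.
rewrite !ip_symbol//; last exact: bounded_shift.
rewrite mulL2_shift_symbol// ipBl ipZl.
have -> : ip (mulL2 theta phi) (Sa g) = ip mu g.
  by rewrite -ip_proj_K2// ip_conj -ip_adjoint_shift// -ip_conj.
rewrite (compressed_shiftE alpha_inner g) ipBr ipZr mulL2_iso; last exact: unimodular_zpow.
rewrite -(ip_conj g (ktilde0 alpha)).
have -> : ip (mulL2 (zpow 1) (mulL2 f phi)) alpha = ip f nu.
  rewrite [RHS]ip_conj ip_proj_K2// -ip_conj.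
  apply: ip_ae; apply: ae_on_mp (mulL2E phi bf) _.
  apply: ae_on_mp (mulL2E (mulL2 f phi) (bounded_zpow R 1)) _.
  apply: ae_on_mp (conjL2E phi) _.
  apply: ae_on_mp (mulL2E (conjL2 phi) ba) _.
  apply: ae_onS (mulL2E (mulL2 alpha (conjL2 phi)) (bounded_zpow R (-1))) => t.
  by move=> -> -> -> -> ->; rewrite !conjcM conjcK zpowN opprK; ring.
by ring.
Qed.

End necessity.

(** * From the equation to a symbol *)

Section sufficiency.
Variables (mu : K2 alpha) (nu : K2 theta).
Hypothesis A_eq : weak_equation mu nu.

Definition recovered_symbol : L2 R :=
  mulL2 (fun t => zpow 1 t * (theta t)^*%C) mu +
  mulL2 (fun t => zpow (-1) t * alpha t) (conjL2 nu).

Lemma weak_equation_iter (f : K2 theta) (g : K2 alpha) (n : nat) :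
  ip (A f) g = \sum_(0 <= j < n)
    (ip (iter j St f) (ktilde0 theta) * ip mu (iter j Sa g) +
     ip (iter j St f) nu * ip (ktilde0 alpha) (iter j Sa g))
  + ip (A (iter n St f)) (iter n Sa g).
Proof.
elim: n => [|n IH]; first by rewrite big_geq// add0r.
rewrite big_nat_recr//= IH -addrA -(A_eq (iter n St f) (iter n Sa g)).
by rewrite addrNK.
Qed.

(** With [ip_shift_iter], the products <S^n k, m> become the Fourier coefficients of k conj(m) at
    the frequencies -n. *)
Lemma ip_conj_mul (v : L2 R) (k m : K2 v) (n : nat) : bounded_fun_ae k ->
  ip (mulL2 k (conjL2 m)) (negexp R n) = ip (mulL2 (zpow n%:Z) k) m.
Proof.
move=> bk; apply: ip_ae; apply: ae_on_mp (conjL2E m) _.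
apply: ae_on_mp (mulL2E (conjL2 m) bk) _.
apply: ae_on_mp (expL2E R (- n%:Z)) _.
apply: ae_onS (mulL2E k (bounded_zpow R n)) => t.
by move=> -> -> -> ->; rewrite zpowN opprK; ring.
Qed.

Lemma ip_psum_l (v : nat -> L2 R) x y n :
  ip (psum v x n) y = \sum_(0 <= j < n) ip x (v j) * conjc (ip y (v j)).
Proof.
by rewrite /psum ip_suml; apply: eq_bigr => j _; rewrite ipZl -ip_conj.
Qed.

(** In the second family it is g that carries the [ktilde0] coefficients, so f and g exchange roles
    and the sum appears conjugated. *)
Lemma symbol_sum (f : K2 theta) (g : K2 alpha) (n : nat) :
  bounded_fun_ae f -> bounded_fun_ae g ->
  \sum_(0 <= j < n)
    (ip (iter j St f) (ktilde0 theta) * ip mu (iter j Sa g) +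
     ip (iter j St f) nu * ip (ktilde0 alpha) (iter j Sa g)) =
  ip (psum (negexp R) (tail_symbol f) n) (mulL2 g (conjL2 mu)) +
  conjc (ip (psum (negexp R) (tail_symbol g) n) (mulL2 f (conjL2 nu))).
Proof.
move=> bf bg; rewrite big_split.
have Ef := ip_psum_l (negexp R) (tail_symbol f) (mulL2 g (conjL2 mu)) n.
have Eg := ip_psum_l (negexp R) (tail_symbol g) (mulL2 f (conjL2 nu)) n.
apply: etrans _ (esym (congr2 (fun x y => x + conjc y) Ef Eg)).
apply: (congr2 +%R).
  apply: eq_bigr => j _; rewrite ip_shift_iter_ktilde0//; congr (_ * _).
  by rewrite ip_conj ip_shift_iter// ip_conj_mul.
rewrite (big_morph (@conjc R) (@conjcD R) (@conjc0 R)); apply: eq_bigr => j _.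
rewrite conjcM conjcK mulrC; congr (_ * _); last by rewrite ip_shift_iter// ip_conj_mul.
by rewrite ip_conj ip_shift_iter_ktilde0.
Qed.

(** The symbol is put on the side of [g], so that the right-hand side keeps its meaning once [f] may
    be unbounded. *)
Lemma ip_recovered_symbol (f : K2 theta) (g : K2 alpha) :
  bounded_fun_ae f -> bounded_fun_ae g ->
  ip (tail_symbol f) (mulL2 g (conjL2 mu)) +
    conjc (ip (tail_symbol g) (mulL2 f (conjL2 nu))) =
  ip f (mulL2 g (conjL2 recovered_symbol)).
Proof.
move=> bf bg.
have b1 := bounded_funM (bounded_zpow R 1) (bounded_funC bt).
have b2 := bounded_funM (bounded_zpow R (-1)) ba.
pose phi1 := mulL2 (fun t => zpow 1 t * (theta t)^*%C) mu.
pose phi2 := mulL2 (fun t => zpow (-1) t * alpha t) (conjL2 nu).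
have -> : ip (tail_symbol f) (mulL2 g (conjL2 mu)) = ip (mulL2 f phi1) g.
  apply: ip_ae; apply: ae_on_mp (conjL2E mu) _.
  apply: ae_on_mp (mulL2E (conjL2 mu) bg) _.
  apply: ae_on_mp (mulL2E f (bounded_funC bt)) _.
  apply: ae_on_mp (mulL2E (mulL2 (fun t => (theta t)^*%C) f) (bounded_zpow R 1)) _.
  apply: ae_on_mp (mulL2E mu b1) _.
  apply: ae_onS (mulL2E phi1 bf) => t.
  by move=> -> -> -> -> -> ->; rewrite conjcM conjcK; ring.
have -> : conjc (ip (tail_symbol g) (mulL2 f (conjL2 nu))) = ip (mulL2 f phi2) g.
  rewrite -ip_conj; apply: ip_ae; apply: ae_on_mp (conjL2E nu) _.
  apply: ae_on_mp (mulL2E (conjL2 nu) b2) _.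
  apply: ae_on_mp (mulL2E (conjL2 nu) bf) _.
  apply: ae_on_mp (mulL2E g (bounded_funC ba)) _.
  apply: ae_on_mp (mulL2E (mulL2 (fun t => (alpha t)^*%C) g) (bounded_zpow R 1)) _.
  apply: ae_onS (mulL2E phi2 bf) => t.
  by move=> -> -> -> -> -> ->; rewrite !conjcM conjcK zpowN; ring.
rewrite -ipDl -mulL2D// -/recovered_symbol.
apply: ip_ae; apply: ae_on_mp (conjL2E recovered_symbol) _.
apply: ae_on_mp (mulL2E (conjL2 recovered_symbol) bg) _.
apply: ae_onS (mulL2E recovered_symbol bf) => t.
by move=> -> -> ->; rewrite conjcM conjcK; ring.
Qed.

Lemma ip_recovered_bounded (f : K2 theta) (g : K2 alpha) :
  bounded_fun_ae f -> bounded_fun_ae g ->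
  ip (A f) g = ip f (mulL2 g (conjL2 recovered_symbol)).
Proof.
move=> bf bg; apply/eqP; rewrite -subr_eq0; apply/eqP.
have [C C0 AC] := bounded_op_nrm2.
set x := tail_symbol f; set y := mulL2 g (conjL2 mu).
set x' := tail_symbol g; set y' := mulL2 f (conjL2 nu).
apply: (@abs2_small _ _ (4 * nrm2 y + 4 * nrm2 y' + 2 * C * nrm2 g)) => [|eps e0].
  by rewrite !addr_ge0// !mulr_ge0// nrm2_ge0.
have [N NP] := tail_symbol_series theta_inner f e0.
have [N' NP'] := tail_symbol_series alpha_inner g e0.
pose n := maxn N N'.
have xn : nrm2 (psum (negexp R) x n - x) <= eps by apply: NP; exact: leq_maxl.
have xn' : nrm2 (psum (negexp R) x' n - x') <= eps by apply: NP'; exact: leq_maxr.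
(* The remainder needs no index of its own: its squared norm is that of the series tail bounded just
   above. *)
have Stn : nrm2 (iter n St f) <= eps.
  by rewrite (nrm2_shift_iter theta_inner f n) nrm2BC; exact: xn.
rewrite -ip_recovered_symbol// (weak_equation_iter f g n) symbol_sum// -/x -/x' -/y -/y'.
set p := psum _ x n in xn *; set p' := psum _ x' n in xn' *; set r := ip (A _) _.
have -> : ip p y + conjc (ip p' y') + r - (ip x y + conjc (ip x' y')) =
    ip (p - x) y + conjc (ip (p' - x') y') + r.
  by rewrite !ipBl rmorphB; ring.
have h1 : abs2 (ip (p - x) y) <= eps * nrm2 y.
  apply: (le_trans (cauchy_schwarz (p - x) y)).
  exact: ler_wpM2r (nrm2_ge0 y) _ _ xn.
have h2 : abs2 (conjc (ip (p' - x') y')) <= eps * nrm2 y'.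
  rewrite abs2C; apply: (le_trans (cauchy_schwarz (p' - x') y')).
  exact: ler_wpM2r (nrm2_ge0 y') _ _ xn'.
have h3 : abs2 r <= C * eps * nrm2 g.
  apply: le_trans (cauchy_schwarz _ _) _; apply: ler_pM; try exact: nrm2_ge0.
    apply: le_trans (AC _) _; exact: ler_wpM2l C0 _ _ Stn.
  exact: nrm2_shift_iter_le alpha_inner _ _.
exact: abs2D3_le h1 h2 h3.
Qed.

(** g conj(phi) is square integrable for bounded g, so both sides are bounded functionals of f and
    density applies. *)
Lemma ip_recovered (f : K2 theta) (g : K2 alpha) : bounded_fun_ae g ->
  ip (A f) g = ip f (mulL2 g (conjL2 recovered_symbol)).
Proof.
move=> bg; move: f; apply: (bounded_functional_eq theta_inner).
- exact: bounded_functional_A.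
- exact: bounded_functional_ipl.
- by move=> f bf; exact: ip_recovered_bounded.
Qed.

(** Here f is any element of the domain of the symbol, so density is used in the other variable,
    g. *)
Lemma recovered_Atrunc (f : K2 theta) : Adom recovered_symbol f ->
  A f = Atrunc alpha recovered_symbol f.
Proof.
set phi := recovered_symbol => domf; apply: K2_ext => g.
(* Conjugating puts [g] in the linear slot, as [bounded_functional_ipl] expects. *)
rewrite ip_conj [RHS]ip_conj; congr conjc.
move: g; apply: (bounded_functional_eq alpha_inner); try exact: bounded_functional_ipl.
move=> g bg; rewrite ip_conj [RHS]ip_conj; congr conjc.
rewrite ip_recovered// ip_proj_K2//.
apply: ip_ae; apply: ae_on_mp (toL2P domf) _; apply: ae_on_mp (conjL2E phi) _.
apply: ae_onS (mulL2E (conjL2 phi) bg) => t.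
by move=> -> -> ->; rewrite conjcM conjcK; ring.
Qed.

Lemma recovered_ATTO : ATTO A.
Proof.
split=> //; exists recovered_symbol; split; last exact: recovered_Atrunc.
have [c Ac] := A_bounded; exists c => f domf.
by rewrite -recovered_Atrunc.
Qed.

End sufficiency.

End characterization.

Theorem theorem6p1 (R : realType) (alpha theta : L2 R)
    (alpha_inner : inner_function alpha) (theta_inner : inner_function theta)
    (alpha_nonconst : nonconstant alpha) (theta_nonconst : nonconstant theta)
    (alpha_dvd_theta : divides alpha theta)
    (A : {linear K2 theta -> K2 alpha}) (A_bounded : bounded_op A) :
  ATTO A <->
  exists (mu : K2 alpha) (nu : K2 theta), forall f : K2 theta,
    K2val (A f - adjoint_op (@compressed_shift R alpha) (A (compressed_shift f))) =
    rank_one mu (ktilde0 theta) f + rank_one (ktilde0 alpha) nu f.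
Proof.
split=> [[_ [phi [_ A_phi]]]|[mu [nu H]]].
  exists (adjoint_op (@compressed_shift R alpha) (proj_K2 alpha (mulL2 theta phi))).
  exists (proj_K2 theta (mulL2 (zpow (-1)) (mulL2 alpha (conjL2 phi)))).
  apply/weak_equationP => //; exact: symbol_weak_equation.
apply: (recovered_ATTO alpha_inner theta_inner A_bounded (mu := mu) (nu := nu)).
exact/weak_equationP.
Qed.
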